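(* For all $d\ge 3$ and $T\in(0,\infty)$, there is a $u_c=u_c(d,T)\in(0,\infty)$ such that $\mathcal{FI}^{u,T}$ percolates almost surely for all $u\in(u_c,\infty)$, and does not percolate almost surely for all $u\in(0,u_c)$.
   Context: $\mathbb{L}^d=\{\{x,y\}: x,y\in\mathbb{Z}^d,\ |x-y|_2=1\}$ is the set of undirected nearest-neighbor edges of $\mathbb{Z}^d$ ($|\cdot|_2$ is the Euclidean norm). For $T\in(0,\infty)$ and $x\in\mathbb{Z}^d$, $P_x^{(T)}$ is the law of the simple random walk on $\mathbb{Z}^d$ started at $x$ and killed with probability $\frac1{T+1}$ at each step: the number of steps $N$ (the length of the path) satisfies $P(N=k)=\left(\frac{T}{T+1}\right)^k\frac{1}{T+1}$ for $k=0,1,2,\dots$ (mean $T$) and is independent of the underlying simple random walk. $P_x^{(T)}$ is regarded as a measure on the set $W^{[0,\infty)}$ of finite nearest-neighbor paths in $\mathbb{Z}^d$. For $0<u,T<\infty$, the finitary random interlacement $\mathcal{FI}^{u,T}$ is the Poisson point process on $W^{[0,\infty)}$ with intensity measure $u\sum_{x\in\mathbb{Z}^d}\frac{2d}{T+1}P_x^{(T)}$. Equivalently, with $\{N_x\}_{x\in\mathbb{Z}^d}$ i.i.d. Poisson of parameter $\frac{2du}{T+1}$, one starts $N_x$ independent killed walks of law $P_x^{(T)}$ from each $x\in\mathbb{Z}^d$, and $\mathcal{FI}^{u,T}$ is the point measure consisting of all these trajectories. It is also regarded as a bond percolation model: an edge $e\in\mathbb{L}^d$ is open iff some path in $\mathcal{FI}^{u,T}$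 traverses $e$. $\mathcal{FI}^{u,T}$ percolates iff there is an infinite connected cluster composed of open edges. *)

(* Defs.v *)
From HB Require Import structures.
From Stdlib Require Import Relation_Operators.
From mathcomp Require Import all_boot all_order all_algebra.
From mathcomp Require Import all_classical all_reals all_analysis.
From mathcomp Require Import measurable_realfun.

Set Implicit Arguments.
Unset Strict Implicit.
Unset Printing Implicit Defensive.

Import Order.TTheory GRing.Theory Num.Theory.

Local Open Scope classical_set_scope.
Local Open Scope ring_scope.

Section measure_sum.
Local Open Scope ereal_scope.
Context d (T : measurableType d) (R : realType) (I : choiceType).
Variable m : I -> {measure set T -> \bar R}.

(* Unlike mseries, the family may be indexed by any choiceType. *)
Definition msumT (A : set T) : \bar R := \esum_(i in [set: I]) m i A.

Let msumT0 : msumT set0 = 0.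
Proof. by rewrite /msumT esum1// => i _; rewrite measure0. Qed.

Let msumT_ge0 A : 0 <= msumT A.
Proof. by apply: esum_ge0. Qed.

Let msumT_sigma_additive : semi_sigma_additive msumT.
Proof.
move=> F mF tF mUF.
rewrite [X in _ --> X](_ : _ = \sum_(0 <= k <oo) msumT (F k)); last first.
  rewrite nneseries_esumT//.
  under [RHS]eq_esum do rewrite /msumT.
  rewrite /msumT.
  under eq_esum.
    move=> i _; rewrite measure_semi_bigcup// nneseries_esumT//; over.
  rewrite !esum_esum//.
  rewrite (reindex_esum ([set: I] `*`` (fun=> [set: nat]))
                        ([set: nat] `*`` (fun=> [set: I]))
                        (fun x => (x.2, x.1)))//.
  split.
  - by move=> [i n].
  - by move=> [? ?] [? ?] _ _ [-> ->].
  - by move=> [n i] _; exists (i, n).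
by apply: is_cvg_ereal_nneg_natsum => k _.
Qed.

HB.instance Definition _ := isMeasure.Build _ _ _ msumT
  msumT0 msumT_ge0 msumT_sigma_additive.

End measure_sum.

Section poisson_point_process.
Local Open Scope ereal_scope.
Context d (E : measurableType d) d' (Omega : measurableType d') (R : realType).

(* The second argument of poisson_prob is unused by the library; poisson_prob 0
   is the Dirac mass at 0 (poisson_pmf 0 is not). *)
Record poisson_point_process (mu : set E -> \bar R) (P : probability Omega R)
    (N : Omega -> {measure set E -> \bar R}) : Prop := PoissonPointProcess {
  ppp_measurable : forall A, measurable A ->
    measurable_fun [set: Omega] (fun w => N w A) ;
  ppp_counting : forall w A, measurable A ->
    N w A = +oo \/ exists k : nat, N w A = k%:R%:E ;
  ppp_poisson : forall A (r : R), measurable A -> mu A = r%:E ->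
    forall k : nat, P [set w | N w A = k%:R%:E] = poisson_prob r 0 [set k] ;
  ppp_infinite : forall A, measurable A -> mu A = +oo ->
    P [set w | N w A = +oo] = 1 ;
  ppp_indep : forall n (A : 'I_n -> set E),
    (forall i, measurable (A i)) -> trivIset [set: 'I_n] A ->
    forall B : 'I_n -> set (\bar R), (forall i, measurable (B i)) ->
    P (\bigcap_i [set w | B i (N w (A i))]) =
    \prod_(i < n) P [set w | B i (N w (A i))] }.

End poisson_point_process.

Section paths.
Variable d : nat.
Implicit Types x y z : 'rV[int]_d.

(* |x - y|_2 = 1, squared so as to stay in the integers *)
Definition adj x y : bool := \sum_i (x 0 i - y 0 i) ^+ 2 == 1.

(* A path is given by its starting point and the list of the vertices it
   visits afterwards, so that the length of that list is its number of steps. *)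
Definition npath : Type :=
  {w : 'rV[int]_d * seq 'rV[int]_d | path adj w.1 w.2}.

HB.instance Definition _ := Countable.on npath.

Definition npath_start (w : npath) : 'rV[int]_d := (val w).1.
Definition npath_length (w : npath) : nat := size (val w).2.

Definition npath_steps (w : npath) : seq ('rV[int]_d * 'rV[int]_d) :=
  zip ((val w).1 :: (val w).2) (val w).2.

Definition traverses (w : npath) y z : bool :=
  ((y, z) \in npath_steps w) || ((z, y) \in npath_steps w).

HB.instance Definition _ := isPointed.Build npath
  (exist (fun w : 'rV[int]_d * seq 'rV[int]_d => path adj w.1 w.2)
    (0, [::]) isT).

HB.instance Definition _ := @isMeasurable.Build default_measure_display
  npath discrete_measurable discrete_measurable0
  discrete_measurableC discrete_measurableU.

End paths.

Section killed_walk.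
Context (R : realType) (d : nat).
Implicit Types (x y z : 'rV[int]_d) (T u : {posnum R}).

Definition srw_step y z : R := if adj y z then (2 * d)%:R^-1 else 0.

(* probability that (X_0, ..., X_k) = w for the walk X started at x; it is 0
   unless w has k steps *)
Definition srw_mass x (k : nat) (w : npath d) : R :=
  if (npath_start w == x) && (npath_length w == k)
  then \prod_(e <- npath_steps w) srw_step e.1 e.2 else 0.

Lemma srw_mass_ge0 x k w : 0 <= srw_mass x k w.
Proof.
rewrite /srw_mass; case: ifP => // _; apply: prodr_ge0 => e _.
by rewrite /srw_step; case: ifP => // _; rewrite invr_ge0.
Qed.

Definition srw_law x (k : nat) : {measure set (npath d) -> \bar R} :=
  msumT (fun w : npath d => mscale (NngNum (srw_mass_ge0 x k w)) \d_w).

Definition geom_mass T (k : nat) : R :=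
  (T%:num / (T%:num + 1)) ^+ k * (T%:num + 1)^-1.

Lemma geom_mass_ge0 T k : 0 <= geom_mass T k.
Proof. by rewrite /geom_mass mulr_ge0// exprn_ge0. Qed.

(* The number of steps is independent of the walk, so the law of the stopped
   path is the mixture over k of the laws of the first k steps. *)
Definition killed_walk T x : {measure set (npath d) -> \bar R} :=
  mseries (fun k => mscale (NngNum (geom_mass_ge0 T k)) (srw_law x k)) 0.

Definition fri_intensity u T : {measure set (npath d) -> \bar R} :=
  mscale u%:num%:nng
    (msumT (fun x => mscale ((2 * d)%:R / (T%:num + 1))%:nng
                            (killed_walk T x))).

End killed_walk.

Section percolation.
Context (R : realType) (d : nat) (m : set (npath d) -> \bar R).

(* Undirected edges {x, y} are encoded by the symmetric relation traverses. *)
Definition open_edge (x y : 'rV[int]_d) : Prop :=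
  exists2 w : npath d, (0 < m [set w])%E & traverses w x y.

Definition open_cluster (x : 'rV[int]_d) : set 'rV[int]_d :=
  [set y | clos_refl_trans _ open_edge x y].

Definition percolates : Prop := exists x, infinite_set (open_cluster x).

End percolation.

Definition finitary_interlacement (R : realType) (dim : nat) (u T : {posnum R})
    d (Omega : measurableType d) (P : probability Omega R)
    (FI : Omega -> {measure set (npath dim) -> \bar R}) : Prop :=
  poisson_point_process (fri_intensity dim u T) P FI.

(* Main.v *)
Require Import Defs.
From Stdlib Require Import Relation_Operators Operators_Properties.
From mathcomp Require Import all_boot all_order all_algebra.
From mathcomp Require Import all_classical all_reals all_analysis.
From mathcomp Require Import measurable_realfun.
From mathcomp Require Import zify ring lra.

Set Implicit Arguments.
Unset Strict Implicit.
Unset Printing Implicit Defensive.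

Import Order.TTheory GRing.Theory Num.Theory.
Local Open Scope classical_set_scope.
Local Open Scope ring_scope.

(** Only the set of open paths matters, a path [w] being open if the process
    charges it. The events that the paths are open are independent, with
    probability [1 - exp (- u c_w)], where [c_w] is the intensity of [w] at
    [u = 1] ([fri_intensity_set1], [prob_cyl]). So the model is a percolation by
    independent, finite, connected clumps of edges, indexed by a countable set.

    Zero-one law ([percol_event01]). Deleting one path from a set of paths breaks
    an infinite cluster into finitely many pieces, one of which is infinite
    ([percol_del]); hence percolation is not affected by finitely many paths. As
    it is also a monotone limit of events about finitely many paths, it is
    independent of each such event, thus of itself.

    Critical value. The probability that, within finitely many paths, a given
    point has a cluster of at least [n] points is an explicit sum [Ex], which does
    not refer to the probability space and is nondecreasing in [u]
    ([Ex_le_prob]). Call [u] supercritical if for some point these probabilities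
    are bounded away from zero as [n] grows, with the finite set of paths
    depending on [n]. By continuity of the probability and the zero-one law,
    percolation has probability one if [u] is supercritical and zero otherwise, so
    that [u_c] is the infimum of the supercritical values, and it remains to show
    that this infimum is positive and finite.

    Low intensity ([not_supercritical_low]). A point of the cluster of [x] other
    than [x] belongs to the cluster, formed without [w], of a vertex of some open
    [w] through [x] ([conn_first]). Taking expectations and inducting on the
    number of paths bounds the expected size of a cluster by [1 / (1 - kappa)] if
    [kappa < 1], where [kappa] bounds, for every [x], the sum over the paths [w]
    through [x] of the number of vertices of [w] times the probability that [w] is
    open ([expected_cluster]). By counting paths through a point, a constant times
    [u] is such a bound ([weight_through_le]).

    High intensity ([supercritical_high]). Only the one-step paths along the edges
    of a quadrant are used, each open with a probability close to one. Percolation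
    is shown by block renormalisation instead of a contour argument. A block of
    level [n + 1] consists of [(n + 2) ^ 2] by [(n + 2) ^ 2] blocks of level [n]
    and is good if at most one of them is not. By induction a good block contains
    a connected core that meets each of its sides in more than half of the sites;
    two good neighbours are then connected through their common side, by
    pigeonhole ([linked_nxt]), and a square grid of blocks stays connected after
    the removal of one ([good_well_cored]). A block that is not good contains two
    that are not, so the probability of being bad is roughly squared at each level
    ([num_witnesses_le]) and, with probability at least one half, all the blocks
    at the origin are good ([Ex_large_ge]). *)

(** * Block renormalisation in the quadrant *)

(** A block of level [n.+1] is a square of [blk n] by [blk n] blocks of level
    [n]; [side n] is the side length of a block of level [n]. *)
Definition blk (n : nat) : nat := (n.+2 ^ 2)%N.

Lemma blkE n : blk n = (n.+2 * n.+2)%N.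
Proof. by rewrite /blk expnS expn1. Qed.

Lemma blk_gt1 n : (1 < blk n)%N.
Proof. by rewrite blkE. Qed.

Opaque blk.

Fixpoint side (n : nat) : nat := if n is m.+1 then (blk m * side m)%N else 1%N.

(** The number of sites on each side of a good block of level [n] that are
    guaranteed to lie in its core. *)
Fixpoint hits (n : nat) : nat :=
  if n is m.+1 then ((blk m).-1 * hits m)%N else 1%N.

(** The factor [1 - 1 / blk m] lost at each level has a telescoping product, so
    that the core always contains more than half of each side. *)
Lemma hits_side n : (2 * n.+1 * hits n = n.+2 * side n)%N.
Proof.
elim: n => [//|n IH]; rewrite -[hits n.+1]/((blk n).-1 * hits n)%N.
rewrite -[side n.+1]/(blk n * side n)%N.
have -> : (blk n).-1 = (n.+1 * n.+3)%N by rewrite blkE; lia.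
rewrite blkE.
have -> : (2 * n.+2 * (n.+1 * n.+3 * hits n) =
   n.+2 * n.+3 * (2 * n.+1 * hits n))%N by ring.
by rewrite IH; ring.
Qed.

Lemma side_gt0 n : (0 < side n)%N.
Proof. by elim: n => //= n IH; rewrite muln_gt0 IH ltnW ?blk_gt1. Qed.

Lemma hits_gt_half n : (side n < 2 * hits n)%N.
Proof. by have := hits_side n; have := side_gt0 n; nia. Qed.

Lemma hits_ge n : (n < hits n)%N.
Proof.
elim: n => // n IH; rewrite -[hits n.+1]/((blk n).-1 * hits n)%N.
apply: (@leq_trans (2 * hits n)); first by lia.
rewrite leq_mul2r; apply/orP; right.
have : (3 < blk n)%N by rewrite blkE; lia.
by case: (blk n) => [|l] //= /ltnW.
Qed.

(** The coordinates of [c] if [b], else the transposed ones: lets one statement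
    cover horizontal and vertical directions. *)
Definition sw (b : bool) (c : nat * nat) : nat * nat :=
  if b then c else (c.2, c.1).

Lemma swK b c : sw b (sw b c) = c.
Proof. by case: b; case: c. Qed.

(** The neighbour of [c] in the direction [b]. *)
Definition nxt (b : bool) (c : nat * nat) : nat * nat :=
  sw b ((sw b c).1.+1, (sw b c).2).

(** The sub-block at position [a] of the block [c] of level [n.+1]. *)
Definition sub_block (n : nat) (c a : nat * nat) : nat * nat :=
  (blk n * c.1 + a.1, blk n * c.2 + a.2)%N.

Lemma sw_sub b n c a : sw b (sub_block n c a) = sub_block n (sw b c) (sw b a).
Proof. by case: b. Qed.

Definition in_range (n : nat) (a : nat * nat) : bool :=
  (a.1 < blk n)%N && (a.2 < blk n)%N.

Lemma in_range_sw b n a : in_range n (sw b a) = in_range n a.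
Proof. by case: b; rewrite // /in_range /= andbC. Qed.

Section blocks.
Variable op : nat * nat -> Prop.

(** A site is good if it is open; a block of level [n.+1] is good if at most one
    of its blocks of level [n] is not good. *)
Fixpoint good (n : nat) (c : nat * nat) : Prop :=
  if n is m.+1 then
    exists e, forall a, in_range m a -> a <> e -> good m (sub_block m c a)
  else op c.

(** The union of the cores of the good sub-blocks, down to the open sites. *)
Fixpoint core (n : nat) (c v : nat * nat) : Prop :=
  if n is m.+1 then
    exists a, [/\ in_range m a, good m (sub_block m c a)
                & core m (sub_block m c a) v]
  else v = c.

(** The [y]-th site on the far ([s = true]) or near ([s = false]) side of the
    block [c] in the direction [b]. *)
Definition side_pt n c b s y : nat * nat :=
  sw b (side n * (sw b c).1 + (if s then (side n).-1 else 0),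
        side n * (sw b c).2 + y)%N.

(** The number of sites of that side that lie in the core. *)
Definition side_count n c b s : nat :=
  count (fun y => `[< core n c (side_pt n c b s y) >]) (iota 0 (side n)).

Lemma core_open n c v : good n c -> core n c v -> op v.
Proof.
elim: n c => [c /= gc ->//|n IH c _ /= [a [_ ga ca]]]; exact: IH ga ca.
Qed.

Lemma side_pt_sub n c b s y j :
  (j < blk n)%N ->
  side_pt n (sub_block n c (sw b ((if s then (blk n).-1 else 0)%N, j))) b s y =
  side_pt n.+1 c b s (j * side n + y).
Proof.
move=> hj; rewrite /side_pt !sw_sub !swK -[side n.+1]/(blk n * side n)%N.
rewrite /sub_block; move: (blk n) hj (side_gt0 n) => l hj hL.
rewrite /=; congr (sw b (_, _)); last by ring.
case: s; last by ring.
have -> : (l * side n).-1 = (l.-1 * side n + (side n).-1)%N.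
  by case: l hj => // l _; case: (side n) hL => // L _; rewrite mulSn; lia.
by ring.
Qed.

(** If all but one of the [l] consecutive windows of length [k] contain at least
    [m] points of [Q], then all of them together contain at least [l.-1 * m]. *)
Lemma count_windows (Q : pred nat) l k m (e : nat) :
  (forall j, (j < l)%N -> j <> e ->
     (m <= count (fun y => Q (j * k + y)%N) (iota 0 k))%N) ->
  (l.-1 * m <= count Q (iota 0 (l * k)))%N.
Proof.
move=> H.
suff : ((l - (e < l)%N) * m <= count Q (iota 0 (l * k)))%N.
  apply: leq_trans; rewrite leq_mul2r; apply/orP; right.
  by case: (e < l)%N; lia.
elim: l H => [//|l IH] H.
rewrite mulSn addnC iotaD count_cat add0n.
have -> : count Q (iota (l * k) k) =
          count (fun y => Q (l * k + y)%N) (iota 0 k).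
  by rewrite -{1}[(l * k)%N]addn0 iotaDl count_map.
have {}IH := IH (fun j hj => H j (ltnW hj)).
have [el|el] := eqVneq l e.
  apply: leq_trans (leq_addr _ _); apply: leq_trans IH.
  by rewrite leq_mul2r el ltnSn ltnn subn1 subn0 leqnn orbT.
have Hl := H l (ltnSn l) (elimN eqP el).
apply: leq_trans (leq_add IH Hl).
rewrite addnC -mulSn leq_mul2r; apply/orP; right.
have -> : (e < l.+1)%N = (e < l)%N by rewrite ltnS leq_eqVlt eq_sym (negbTE el).
by case: (ltnP e l); lia.
Qed.

Lemma count_common (P Q : pred nat) (s : seq nat) :
  (size s < count P s + count Q s)%N -> exists2 y, y \in s & P y && Q y.
Proof.
rewrite -count_predUI => h.
have /hasP[y ys yPQ] : has (predI P Q) s.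
  by rewrite has_count; have := count_size (predU P Q) s; lia.
by exists y.
Qed.

Section connection.
Variable cn : nat * nat -> nat * nat -> Prop.
Hypothesis cn_refl : forall x, cn x x.
Hypothesis cn_sym : forall x y, cn x y -> cn y x.
Hypothesis cn_trans : forall x y z, cn x y -> cn y z -> cn x z.
Hypothesis cn_nxt : forall b x, op x -> cn x (nxt b x).

(** The cores of the blocks [c] and [c'] are connected to each other. *)
Definition linked n c c' : Prop :=
  forall u v, core n c u -> core n c' v -> cn u v.

(** The core of [c] is connected and meets each side often. *)
Definition well_cored n c : Prop :=
  linked n c c /\ forall b s, (hits n <= side_count n c b s)%N.

Lemma well_cored_ex n c : well_cored n c -> exists v, core n c v.
Proof.
move=> [_ /(_ true true) h].
have /hasP[y _ /asboolP cy] : has (fun y =>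
    `[< core n c (side_pt n c true true y) >]) (iota 0 (side n)).
  by rewrite has_count; apply: leq_trans h; apply: leq_trans (hits_ge n).
by eexists; exact: cy.
Qed.

Lemma linked_trans n c1 c2 c3 : well_cored n c2 ->
  linked n c1 c2 -> linked n c2 c3 -> linked n c1 c3.
Proof.
move=> /well_cored_ex[w cw] h12 h23 u v cu cv.
by apply: cn_trans (h12 _ _ cu cw) (h23 _ _ cw cv).
Qed.

Lemma linked_sym n c1 c2 : linked n c1 c2 -> linked n c2 c1.
Proof. by move=> h u v cu cv; apply/cn_sym/h. Qed.

(** Two good neighbouring blocks are linked: each core contains more than half
    of the common side, so they meet it at the same height. *)
Lemma linked_nxt n b c : good n c -> well_cored n c -> well_cored n (nxt b c) ->
  linked n c (nxt b c).
Proof.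
move=> gc [lc hc] [lc' hc'].
have [|y ys /andP[/asboolP h1 /asboolP h2]] := @count_common
    (fun y => `[< core n c (side_pt n c b true y) >])
    (fun y => `[< core n (nxt b c) (side_pt n (nxt b c) b false y) >])
    (iota 0 (side n)).
  rewrite size_iota; apply: leq_trans (hits_gt_half n) _.
  by rewrite mul2n -addnn; apply: leq_add; [exact: hc|exact: hc'].
move=> u v cu cv; apply: cn_trans (lc _ _ cu h1) _.
apply: cn_trans (lc' _ _ h2 cv).
suff -> : side_pt n (nxt b c) b false y = nxt b (side_pt n c b true y).
  by apply: cn_nxt; exact: core_open gc h1.
rewrite /side_pt /nxt !swK /=; congr (sw b (_, _)).
by have := side_gt0 n; rewrite mulnS; case: (side n) => // L _ /=; lia.
Qed.

Section step.
Variable n : nat.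
Hypothesis IH : forall c, good n c -> well_cored n c.

(** Along a line of good blocks all cores are connected. *)
Lemma linked_line b c j a a' :
  (forall i, (i < blk n)%N -> good n (sub_block n c (sw b (i, j)))) ->
  (a < blk n)%N -> (a' < blk n)%N ->
  linked n (sub_block n c (sw b (a, j))) (sub_block n c (sw b (a', j))).
Proof.
move=> h.
have h0 : (0 < blk n)%N := ltnW (blk_gt1 n).
suff H : forall a, (a < blk n)%N ->
    linked n (sub_block n c (sw b (0%N, j))) (sub_block n c (sw b (a, j))).
  move=> ha ha'; apply: (linked_trans _ _ (H _ ha')); first exact/IH/h.
  by apply/linked_sym/H.
elim=> [_|i IHi hi]; first by have [] := IH (h _ h0).
apply: (linked_trans _ (IHi (ltnW hi))); first exact/IH/h/ltnW.
have -> : sub_block n c (sw b (i.+1, j)) =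
          nxt b (sub_block n c (sw b (i, j))).
  by rewrite /nxt !sw_sub !swK /sub_block /=; case: b {h IHi} => /=; rewrite addnS.
have gi := h _ (ltnW hi); have gi' := h _ hi.
apply: linked_nxt => //; first exact: IH.
have <- : sub_block n c (sw b (i.+1, j)) =
          nxt b (sub_block n c (sw b (i, j))).
  rewrite /nxt !sw_sub !swK /sub_block /=.
  by case: b {h IHi gi gi'} => /=; rewrite addnS.
exact: IH.
Qed.

(** All good sub-blocks are linked to the one at the crossing of a row and a
    column that consist of good sub-blocks. *)
Lemma well_coredS c : good n.+1 c -> well_cored n.+1 c.
Proof.
move=> /= [e he].
have h2 : (1 < blk n)%N := blk_gt1 n.
have h0 : (0 < blk n)%N := ltnW h2.
(* a column and a row avoiding the exceptional sub-block *)
pose r1 : nat := (e.1 == 0%N); pose r2 : nat := (e.2 == 0%N).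
have r1e : r1 <> e.1 by rewrite /r1; case: (e.1).
have r2e : r2 <> e.2 by rewrite /r2; case: (e.2).
have r1b : (r1 < blk n)%N by rewrite /r1; case: eqP.
have r2b : (r2 < blk n)%N by rewrite /r2; case: eqP.
pose hub := sub_block n c (r1, r2).
have row j : (j < blk n)%N -> j <> e.2 -> forall i, (i < blk n)%N ->
    good n (sub_block n c (sw true (i, j))).
  move=> hj je i hi; apply: he; first by rewrite /in_range /= hi hj.
  by move=> ee; apply: je; rewrite -ee.
have col j : (j < blk n)%N -> j <> e.1 -> forall i, (i < blk n)%N ->
    good n (sub_block n c (sw false (i, j))).
  move=> hj je i hi; apply: he; first by rewrite /in_range /= hi hj.
  by move=> ee; apply: je; rewrite -ee.
have toH a : in_range n a -> good n (sub_block n c a) ->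
    linked n (sub_block n c a) hub.
  case: a => a1 a2 /andP[/= ha1 ha2] ga.
  have [a2e|a2e] := eqVneq a2 e.2; last first.
    apply: (@linked_trans _ _ (sub_block n c (r1, a2))).
    - by apply: IH; apply: (row a2) => //; exact/eqP.
    - by apply: (linked_line (b := true)) => //; apply: row => //; exact/eqP.
    - by apply: (linked_line (b := false)) => //; apply: col.
  have [a1e|a1e] := eqVneq a1 e.1; last first.
    apply: (@linked_trans _ _ (sub_block n c (a1, r2))).
    - by apply: IH; apply: (row r2).
    - by apply: (linked_line (b := false)) => //; apply: col => //; exact/eqP.
    - by apply: (linked_line (b := true)) => //; apply: row.
  (* the exceptional sub-block itself, when it happens to be good *)
  pose b2 := if a2 is a2'.+1 then a2' else 1%N.
  have b2e : b2 <> e.2 by rewrite -a2e /b2; case: (a2) => //; lia.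
  have b2b : (b2 < blk n)%N by rewrite /b2; case: (a2) ha2 => [_|m /ltnW].
  have gb : good n (sub_block n c (a1, b2)) by apply: (row b2).
  apply: (@linked_trans _ _ (sub_block n c (a1, b2))); first exact: IH.
    rewrite /b2 in gb *; case: a2 ha2 {a2e b2 b2e b2b} ga gb => [|a2] ha2 ga gb.
    have E : sub_block n c (a1, 1%N) = nxt false (sub_block n c (a1, 0%N)).
      by rewrite /nxt /sub_block /= !addn0 addn1.
    by rewrite E; apply: linked_nxt => //; [exact: IH|rewrite -E; exact: IH].
    have E : sub_block n c (a1, a2.+1) = nxt false (sub_block n c (a1, a2)).
      by rewrite /nxt /sub_block /= addnS.
    apply/linked_sym; rewrite E.
    by apply: linked_nxt => //; [exact: IH|rewrite -E; exact: IH].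
  apply: (@linked_trans _ _ (sub_block n c (r1, b2))).
  - by apply: IH; apply: (row b2).
  - by apply: (linked_line (b := true)) => //; apply: row.
  - by apply: (linked_line (b := false)) => //; apply: col.
have hubg : good n hub by apply: (row r2).
split=> [u v [a [ra ga cu]] [a' [ra' ga' cv]]|b s].
  have := linked_trans (IH hubg) (toH _ ra ga) (linked_sym (toH _ ra' ga')).
  exact.
apply: (@count_windows _ _ _ _ (sw b e).2) => j hj je.
pose a := sw b ((if s then (blk n).-1 else 0)%N, j).
have ra : in_range n a.
  rewrite /a in_range_sw /in_range hj andbT; move: h0.
  by case: (s) => //; case: (blk n).
have ga : good n (sub_block n c a).
  by apply: he => // ae; apply: je; rewrite -ae /a swK.
have [_ /(_ b s)] := IH ga; rewrite /side_count => h.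
apply: leq_trans h _; apply: sub_count => y /asboolP cy; apply/asboolP.
exists a; split => //.
rewrite -[side_pt _ _ _ _ _]/(side_pt n.+1 c b s (j * side n + y)).
by rewrite -side_pt_sub.
Qed.

End step.

Lemma good_well_cored n c : good n c -> well_cored n c.
Proof.
elim: n c => [c gc|n IH c]; last exact: well_coredS.
split=> [u v -> ->//|b s]; rewrite /side_count -[hits 0]/1%N -has_count /=.
rewrite orbF; apply/asboolP; rewrite /side_pt /=.
by rewrite !mul1n !addn0 if_same addn0 -surjective_pairing swK.
Qed.

(** If all blocks at the origin up to level [n] are good then the origin is
    connected to more than [n] sites. *)
Lemma good_origin_large n : (forall k, (k <= n)%N -> good k (0%N, 0%N)) ->
  exists s : seq (nat * nat), [/\ uniq s, (n < size s)%N &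
    forall v, v \in s -> cn (0%N, 0%N) v].
Proof.
move=> g.
have s0 k : sub_block k (0%N, 0%N) (0%N, 0%N) = (0%N, 0%N).
  by rewrite /sub_block /= !muln0.
have core0 k : (k <= n)%N -> core k (0%N, 0%N) (0%N, 0%N).
  elim: k => [//|k IH] hk /=; exists (0%N, 0%N); rewrite s0.
  split; last exact/IH/ltnW; last exact/g/ltnW.
  by apply/andP; split; exact/ltnW/blk_gt1.
have [lc /(_ true false) hc] := good_well_cored (g n (leqnn n)).
exists [seq side_pt n (0%N, 0%N) true false y | y <- iota 0 (side n)
   & `[< core n (0%N, 0%N) (side_pt n (0%N, 0%N) true false y) >]].
split.
- rewrite map_inj_uniq; first exact/filter_uniq/iota_uniq.
  by move=> y y'; rewrite /side_pt /= => -[/addnI].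
- by rewrite size_map size_filter; apply: leq_trans hc; exact: hits_ge.
- move=> v /mapP[y]; rewrite mem_filter => /andP[/asboolP cy _] ->.
  by apply: lc => //; exact: core0.
Qed.

End connection.

End blocks.

(** * Witnesses of bad blocks *)

Definition cells (n : nat) : seq (nat * nat) :=
  [seq (i, j) | i <- iota 0 (blk n), j <- iota 0 (blk n)].

Lemma mem_cells n a : (a \in cells n) = in_range n a.
Proof.
apply/allpairsP/idP => [[[i j] /= []]|/andP[h1 h2]].
  by rewrite !mem_iota !add0n /in_range => /andP[_ ?] /andP[_ ?] -> /=; apply/andP.
by exists a; rewrite !mem_iota !add0n h1 h2; case: (a).
Qed.

(** The sets of edges one of which must be closed altogether if the block [c] of
    level [n] is not good: a bad block has two bad sub-blocks. An edge is given
    by its lower left end point and its direction. *)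
Fixpoint witnesses (n : nat) (c : nat * nat) : seq (seq (nat * nat * bool)) :=
  if n is m.+1 then
    flatten [seq [seq w1 ++ w2 | w1 <- witnesses m (sub_block m c a.1),
                                 w2 <- witnesses m (sub_block m c a.2)]
            | a <- [seq (a1, a2) | a1 <- cells m, a2 <- cells m] & a.1 != a.2]
  else [:: [:: (c, true)]; [:: (c, false)]].

Lemma witnessesSP n c w : w \in witnesses n.+1 c ->
  exists a1 a2 w1 w2, [/\ [/\ in_range n a1, in_range n a2 & a1 != a2],
    w1 \in witnesses n (sub_block n c a1),
    w2 \in witnesses n (sub_block n c a2) & w = w1 ++ w2].
Proof.
move=> /flattenP[s /mapP[a]]; rewrite mem_filter => /andP[ne].
move=> /allpairsP[[a1 a2] /= [h1 h2 ae]] ->; rewrite {a}ae /= in ne *.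
move=> /allpairsP[[w1 w2] /= [? ? ->]].
by exists a1, a2, w1, w2; rewrite -!mem_cells.
Qed.

Lemma witnesses_block n c w e : w \in witnesses n c -> e \in w ->
  (e.1.1 %/ side n)%N = c.1 /\ (e.1.2 %/ side n)%N = c.2.
Proof.
elim: n c w => [c w|n IH c w /witnessesSP[a1 [a2 [w1 [w2 [[r1 r2 _] h1 h2 ->]]]]]].
  rewrite !inE => /orP[] /eqP ->; rewrite inE => /eqP -> /=; by rewrite !divn1.
have H a w' : in_range n a -> w' \in witnesses n (sub_block n c a) ->
    e \in w' -> (e.1.1 %/ (side n.+1))%N = c.1 /\ (e.1.2 %/ side n.+1)%N = c.2.
  move=> /andP[ra rb] hw he; have [E1 E2] := IH _ _ hw he.
  rewrite -[side n.+1]/(blk n * side n)%N mulnC.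
  rewrite !(divnMA _ (side n) (blk n)) E1 E2 /sub_block /=.
  have h0 : (0 < blk n)%N := ltnW (blk_gt1 n).
  by rewrite ![(blk n * _)%N]mulnC !divnMDl // !divn_small // !addn0.
by rewrite mem_cat => /orP[]; [exact: H h1|exact: H h2].
Qed.

Lemma witnesses_size n c w : w \in witnesses n c -> size w = (2 ^ n)%N.
Proof.
elim: n c w => [c w|n IH c w /witnessesSP[a1 [a2 [w1 [w2 [_ h1 h2 ->]]]]]].
  by rewrite !inE => /orP[] /eqP ->.
by rewrite size_cat (IH _ _ h1) (IH _ _ h2) addnn -mul2n expnS.
Qed.

Lemma witnesses_uniq n c w : w \in witnesses n c -> uniq w.
Proof.
elim: n c w => [c w|n IH c w /witnessesSP[a1 [a2 [w1 [w2 [[_ _ ne] h1 h2 ->]]]]]].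
  by rewrite !inE => /orP[] /eqP ->.
rewrite cat_uniq (IH _ _ h1) (IH _ _ h2) andbT /=.
apply/hasPn => e e2; apply/negP => e1; move/eqP: ne; apply.
have [E1 E2] := witnesses_block h1 e1; have [F1 F2] := witnesses_block h2 e2.
case: (a1) (a2) E1 E2 F1 F2 => [x y] [x' y'] /= -> -> /addnI -> /addnI ->.
by [].
Qed.

(** An upper bound for the number of witnesses at level [n]. *)
Fixpoint num_witnesses (n : nat) : nat :=
  if n is m.+1 then (blk m ^ 4 * num_witnesses m ^ 2)%N else 2.

Lemma size_flatten_le (T : Type) (ss : seq (seq T)) k :
  all (fun s => size s <= k)%N ss -> (size (flatten ss) <= size ss * k)%N.
Proof.
elim: ss => //= s ss IH /andP[h /IH h']; rewrite size_cat mulSn.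
exact: leq_add.
Qed.

Lemma size_witnesses n c : (size (witnesses n c) <= num_witnesses n)%N.
Proof.
elim: n c => [//|n IH c] /=.
apply: leq_trans (@size_flatten_le _ _ (num_witnesses n ^ 2) _) _.
  apply/allP => s /mapP[a _ ->]; rewrite size_allpairs expnS expn1.
  exact: leq_mul.
rewrite size_map leq_mul2r; apply/orP; right.
rewrite size_filter; apply: leq_trans (count_size _ _) _.
by rewrite !size_allpairs !size_iota !expnS expn0 muln1 !mulnA.
Qed.

Lemma bad_witness (eo : nat * nat * bool -> Prop) n c :
  ~ good (fun v => eo (v, true) /\ eo (v, false)) n c ->
  exists2 w, w \in witnesses n c & forall e, e \in w -> ~ eo e.
Proof.
elim: n c => [c /= /not_andP[] ne|n IH c].
- by exists [:: (c, true)]; rewrite ?inE ?eqxx // => e; rewrite inE => /eqP ->.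
- by exists [:: (c, false)]; rewrite ?inE ?eqxx ?orbT // => e; rewrite inE => /eqP ->.
move=> /= /forallNP H.
have get e : exists a, [/\ in_range n a, a <> e &
    ~ good (fun v => eo (v, true) /\ eo (v, false)) n (sub_block n c a)].
  have /existsNP[a /not_implyP[r /not_implyP[ne b]]] := H e.
  by exists a.
have [a1 [r1 _ /IH[w1 h1 c1]]] := get (0%N, 0%N).
have [a2 [r2 /eqP ne /IH[w2 h2 c2]]] := get a1.
exists (w1 ++ w2); last first.
  by move=> e; rewrite mem_cat => /orP[]; [exact: c1|exact: c2].
apply/flattenP; exists [seq w1 ++ w2 | w1 <- witnesses n (sub_block n c a1),
                                 w2 <- witnesses n (sub_block n c a2)].
  apply/mapP; exists (a1, a2) => //=.
  rewrite mem_filter /= eq_sym ne /=.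
  by apply/allpairsP; exists (a1, a2); rewrite !mem_cells.
by apply/allpairsP; exists (w1, w2).
Qed.

(** * Finite products of Bernoulli measures *)

Section Expectation.
Variables (R : realType) (W : eqType).
Implicit Types (p : W -> R) (A S : seq W) (F G : seq W -> R).

(** The expectation of [F S], where [S] lists the elements of [A] that are kept
    when each [w] in [A] is kept independently with probability [p w]. *)
Fixpoint Ex p A F : R :=
  if A is w :: A' then
    p w * Ex p A' (fun S => F (w :: S)) + (1 - p w) * Ex p A' F
  else F [::].

Definition is_prob p := forall w, 0 <= p w <= 1.

Lemma le_Ex p A F G : is_prob p ->
  (forall S, subseq S A -> F S <= G S) -> Ex p A F <= Ex p A G.
Proof.
move=> hp; elim: A F G => [|w A IH] F G h /=; first exact: h.
have /andP[p0 p1] := hp w.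
apply: lerD; apply: ler_wpM2l => //; rewrite ?subr_ge0 //; apply: IH => S hS.
  by apply: h => /=; rewrite eqxx.
by apply: h; apply: subseq_trans hS (subseq_cons _ _).
Qed.

Lemma eq_Ex p A F G :
  (forall S, subseq S A -> F S = G S) -> Ex p A F = Ex p A G.
Proof.
elim: A F G => [|w A IH] F G h /=; first exact: h.
congr (_ * _ + _ * _); apply: IH => S hS.
  by apply: h => /=; rewrite eqxx.
by apply: h; apply: subseq_trans hS (subseq_cons _ _).
Qed.

Lemma Ex_cst p A c : Ex p A (fun=> c) = c.
Proof. by elim: A => //= w A ->; ring. Qed.

Lemma ExD p A F G : Ex p A (fun S => F S + G S) = Ex p A F + Ex p A G.
Proof. by elim: A F G => //= w A IH F G; rewrite !IH; ring. Qed.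

Lemma ExZ p A c F : Ex p A (fun S => c * F S) = c * Ex p A F.
Proof. by elim: A F => //= w A IH F; rewrite !IH; ring. Qed.

Lemma Ex_sum p A (I : Type) (r : seq I) (Q : pred I) (F : I -> seq W -> R) :
  Ex p A (fun S => \sum_(i <- r | Q i) F i S) = \sum_(i <- r | Q i) Ex p A (F i).
Proof.
elim: r => [|i r IH].
  by rewrite big_nil -[RHS](Ex_cst p A); apply: eq_Ex => S _; rewrite big_nil.
rewrite big_cons -IH; case: ifP => Qi.
  by rewrite -ExD; apply: eq_Ex => S _; rewrite big_cons Qi.
by apply: eq_Ex => S _; rewrite big_cons Qi.
Qed.

(** Increasing functions have an expectation nondecreasing in [p]. *)
Lemma Ex_le_prob p p' A F : is_prob p -> is_prob p' ->
  (forall w, p w <= p' w) ->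
  (forall S S', {subset S <= S'} -> F S <= F S') -> Ex p A F <= Ex p' A F.
Proof.
move=> hp hp' pp'; elim: A F => //= w A IH F mF.
have mF' S S' : {subset S <= S'} -> F (w :: S) <= F (w :: S').
  move=> sub; apply: mF => z; rewrite !inE => /orP[->//|/sub ->].
  by rewrite orbT.
have /IH h1 := mF; have /IH h2 := mF'.
have h3 : Ex p A F <= Ex p A (fun S => F (w :: S)).
  by apply: le_Ex => // S _; apply: mF => z zS; rewrite inE zS orbT.
have h4 := pp' w; have /andP[h5 h6] := hp w; have /andP[h7 h8] := hp' w.
apply: (@le_trans _ _ (p w * Ex p' A (fun S => F (w :: S)) +
   (1 - p w) * Ex p' A F)).
  by apply: lerD; apply: ler_wpM2l => //; rewrite subr_ge0.
have h9 : Ex p' A F <= Ex p' A (fun S => F (w :: S)).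
  by apply: le_Ex => // S _; apply: mF => z zS; rewrite inE zS orbT.
rewrite -subr_ge0.
suff -> : p' w * Ex p' A (fun S => F (w :: S)) + (1 - p' w) * Ex p' A F -
  (p w * Ex p' A (fun S => F (w :: S)) + (1 - p w) * Ex p' A F) =
  (p' w - p w) * (Ex p' A (fun S => F (w :: S)) - Ex p' A F).
  by apply: mulr_ge0; rewrite subr_ge0.
by ring.
Qed.

(** [S] without [w]. *)
Definition del (w : W) S := [seq v <- S | v != w].

Lemma mem_del w S v : (v \in del w S) = (v != w) && (v \in S).
Proof. by rewrite mem_filter. Qed.

Lemma del_id w S : w \notin S -> del w S = S.
Proof.
move=> h; apply/all_filterP/allP => v vS; apply: contraNneq h => <-; exact: vS.
Qed.

(** The event that [w] is kept is independent of what is kept of the rest. *)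
Lemma Ex_del p A w G : uniq A -> w \in A ->
  Ex p A (fun S => if w \in S then G (del w S) else 0) = p w * Ex p (del w A) G.
Proof.
elim: A G => //= v A IH G /andP[vA uA]; rewrite inE; case: eqVneq => [->|wv] /=.
  move=> _.
  rewrite (@eq_Ex _ _ _ G); last first.
    move=> S sS; have vS : v \notin S by apply: contra vA; apply: mem_subseq sS v.
    by rewrite inE eqxx del_id.
  rewrite (@eq_Ex _ _ (fun S => if v \in S then _ else _) (fun=> 0)); last first.
    move=> S sS; have vS : v \notin S by apply: contra vA; apply: mem_subseq sS v.
    by rewrite (negbTE vS).
  by rewrite Ex_cst mulr0 addr0 del_id.
move=> wA; rewrite IH //.
rewrite (@eq_Ex _ _ _
    (fun S => if w \in S then G (v :: del w S) else 0)); last first.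
  by move=> S _; rewrite inE (negbTE wv).
by rewrite (IH (fun S => G (v :: S))) //; ring.
Qed.

Lemma Ex_closed p A (U : seq W) :
  Ex p A (fun S => (all (fun w => w \notin S) U)%:R) =
  \prod_(w <- A | w \in U) (1 - p w).
Proof.
elim: A => [|v A IH] /=; first by rewrite big_nil all_predT.
rewrite big_cons; case: ifPn => vU.
  rewrite (@eq_Ex _ _ _ (fun=> 0)) ?Ex_cst ?mulr0 ?add0r ?IH //.
  move=> S _; apply/eqP; rewrite pnatr_eq0 eqb0; apply/allPn.
  by exists v => //; rewrite negbK inE eqxx.
rewrite (@eq_Ex _ _ _ (fun S => (all (fun w => w \notin S) U)%:R)).
  by rewrite IH; ring.
move=> S _; congr (_%:R); congr nat_of_bool; apply: eq_in_all => w wU.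
by rewrite inE negb_or; case: eqVneq => // wv; rewrite -wv wU in vU.
Qed.

Lemma Ex_closed_cst p q A U : uniq A -> uniq U -> {subset U <= A} ->
  (forall w, w \in U -> p w = 1 - q) ->
  Ex p A (fun S => (all (fun w => w \notin S) U)%:R) = q ^+ size U.
Proof.
move=> uA uU sUA hq; rewrite Ex_closed.
rewrite (eq_bigr (fun=> q)); last by move=> w /hq ->; ring.
rewrite big_const_seq iter_mulr_1; congr (_ ^+ _).
rewrite -size_filter; apply/perm_size/uniq_perm => //; first exact: filter_uniq.
move=> w; rewrite mem_filter; case wU : (w \in U) => //=.
by rewrite sUA.
Qed.

End Expectation.

(** * Clusters formed by a set of paths *)

Section Clusters.
Variable d : nat.
Implicit Types (S : set (npath d)) (w : npath d) (x y z : 'rV[int]_d).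

(** The vertices of [w], with repetition. *)
Definition verts w : seq 'rV[int]_d := (val w).1 :: (val w).2.

(** [x] and [y] are joined by an edge of a path in [S]; [conn S] is the
    reflexive and transitive closure. *)
Definition joined S x y : Prop := exists2 w, S w & traverses w x y.
Definition conn S x y : Prop := clos_refl_trans _ (joined S) x y.

Lemma mem_zip_pair (T : eqType) (s t : seq T) a b :
  (a, b) \in zip s t -> a \in s /\ b \in t.
Proof.
elim: s t => [[]//|u s IH] [//|v t] /=.
rewrite !inE => /orP[/eqP[-> ->]|/IH[-> ->]]; first by rewrite !eqxx.
by rewrite !orbT.
Qed.

Lemma traverses_verts w x y : traverses w x y -> x \in verts w /\ y \in verts w.
Proof.
rewrite /traverses /npath_steps => /orP[]/mem_zip_pair[h1 h2]; split => //;
  by rewrite inE h2 orbT.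
Qed.

Lemma conn_refl S x : conn S x x. Proof. exact: rt_refl. Qed.

Lemma conn_trans S x y z : conn S x y -> conn S y z -> conn S x z.
Proof. exact: rt_trans. Qed.

Lemma conn_joined S x y : joined S x y -> conn S x y.
Proof. exact: rt_step. Qed.

Lemma conn_sym S x y : conn S x y -> conn S y x.
Proof.
elim=> [a b [w Sw t]|a|a b c _ h1 _ h2]; last exact: conn_trans h2 h1.
  by apply: conn_joined; exists w => //; move: t; rewrite /traverses orbC.
exact: conn_refl.
Qed.

Lemma conn_mono S S' x y : S `<=` S' -> conn S x y -> conn S' x y.
Proof.
move=> sub; elim=> [a b [w Sw t]|a|a b c _ h1 _ h2]; last exact: conn_trans h1 h2.
  by apply: conn_joined; exists w => //; exact: sub.
exact: conn_refl.
Qed.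

(** If [w] is used on the way from [x] to [y], then it is left for the last time
    at one of its vertices. *)
Lemma conn_del S w x y : conn S x y ->
  conn (S `\ w) x y \/ exists2 z, z \in verts w & conn (S `\ w) z y.
Proof.
move=> /(clos_rt_rt1n _ _ _ _); elim=> [a|a b c [v Sv t] _ [h|]]; last by right.
  by left; exact: conn_refl.
have [vw|vw] := pselect (v = w).
  by right; exists b => //; rewrite -vw; have [] := traverses_verts t.
left; apply: conn_trans h; apply: conn_joined; exists v => //.
Qed.

Lemma conn_first S x y : conn S x y -> x <> y ->
  exists w z, [/\ S w, x \in verts w, z \in verts w & conn (S `\ w) z y].
Proof.
move=> /(clos_rt_rt1n _ _ _ _); case=> [//|b c [w Sw t] /(clos_rt1n_rt _ _ _ _) h _].
have [xw bw] := traverses_verts t.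
have [h'|[z zw h']] := conn_del w h; first by exists w, b.
by exists w, z.
Qed.

Lemma conn_finite S x y : conn S x y ->
  exists2 s : seq (npath d), [set` s] `<=` S & conn [set` s] x y.
Proof.
elim=> [a b [w Sw t]|a|a b c _ [s1 h1 c1] _ [s2 h2 c2]].
- exists [:: w]; first by move=> v /=; rewrite inE => /eqP ->.
  by apply: conn_joined; exists w => //=; rewrite inE.
- by exists [::] => //; exact: conn_refl.
- exists (s1 ++ s2).
    by move=> v /=; rewrite mem_cat => /orP[/h1|/h2].
  by apply: (@conn_trans _ _ b); [move: c1|move: c2]; apply: conn_mono => v /= vs;
    rewrite mem_cat vs ?orbT.
Qed.

(** The cluster of [x] has at least [n] points. *)
Definition large n x S : Prop := exists Y : seq 'rV[int]_d,
  [/\ uniq Y, (n <= size Y)%N & forall y, y \in Y -> conn S x y].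

Lemma large_mono n x S S' : S `<=` S' -> large n x S -> large n x S'.
Proof.
move=> sub [Y [u l h]]; exists Y; split=> // y /h; exact: conn_mono.
Qed.

Lemma large_finite n x S : large n x S ->
  exists2 s : seq (npath d), [set` s] `<=` S & large n x [set` s].
Proof.
move=> [Y [u l h]].
suff [s sS hs] : exists2 s : seq (npath d), [set` s] `<=` S &
    forall y, y \in Y -> conn [set` s] x y.
  by exists s => //; exists Y.
elim: Y h {u l} => [_|y Y IH h]; first by exists [::].
have [|s1 h1 c1] := IH; first by move=> z zY; apply: h; rewrite inE zY orbT.
have [|s2 h2 c2] := @conn_finite S x y; first by apply: h; rewrite inE eqxx.
exists (s1 ++ s2); first by move=> v /=; rewrite mem_cat => /orP[/h1|/h2].
move=> z; rewrite inE => /orP[/eqP ->|/c1]; last first.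
  by apply: conn_mono => v /= vs; rewrite mem_cat vs.
by move: c2; apply: conn_mono => v /= vs; rewrite mem_cat vs orbT.
Qed.

Lemma infinite_cluster S x :
  infinite_set [set y | conn S x y] <-> forall n, large n x S.
Proof.
split=> [inf n|h].
  have [B sB hB] := infinite_set_fset n inf.
  exists (finmap.enum_fset B); split=> //; first exact: finmap.fset_uniq.
move=> /finite_seqP[s hs].
have [Y [uY lY hY]] := h (size s).+1.
suff : (size Y <= size s)%N by rewrite leqNgt lY.
apply: uniq_leq_size => // y /hY; by rewrite -[conn S x y]/([set y | conn S x y] y) hs.
Qed.

(** Some cluster is infinite. *)
Definition percol S : Prop := exists x, infinite_set [set y | conn S x y].

Lemma percol_mono S S' : S `<=` S' -> percol S -> percol S'.
Proof.
move=> sub [x inf]; exists x; apply: sub_infinite_set inf => y /=; exact: conn_mono.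
Qed.

(** Removing one path breaks a cluster into finitely many pieces, one of which
    is infinite if the cluster is. *)
Lemma percol_del S w : percol S -> percol (S `\ w).
Proof.
move=> [x inf]; apply: contrapT => np; apply: inf.
have fin z : finite_set [set y | conn (S `\ w) z y].
  by apply: contrapT => h; apply: np; exists z.
apply: (@sub_finite_set _ _ ([set y | conn (S `\ w) x y] `|`
   \bigcup_(z in [set` verts w]) [set y | conn (S `\ w) z y])).
  by move=> y /= /(conn_del w)[h|[z zw h]]; [left|right; exists z].
rewrite finite_setU; split=> //.
by apply: bigcup_finite => //; exact: finite_seq.
Qed.

Lemma percol_setD S (s : seq (npath d)) :
  percol (S `\` [set` s]) <-> percol S.
Proof.
split; first exact: percol_mono (@subDsetl _ _ _).
elim: s S => [|w s IH] S h; first by apply: percol_mono h => v Sv; split.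
have := IH _ (percol_del w h); apply: percol_mono => v /= [[Sv vw] vs]; split => //.
by rewrite inE => /orP[/eqP//|].
Qed.

End Clusters.

(** * Absence of percolation at low intensity *)

(** The indicator of a proposition. *)
Definition ind {R : realType} (P : Prop) : R := (`[< P >])%:R.

Lemma ind_ge0 {R : realType} P : 0 <= ind P :> R. Proof. by rewrite ler0n. Qed.

Lemma ind_le {R : realType} (P Q : Prop) : (P -> Q) -> ind P <= ind Q :> R.
Proof.
by move=> h; rewrite ler_nat; case: asboolP => // /h q; rewrite asboolT.
Qed.

Section Subcritical.
Variables (R : realType) (d : nat).
Implicit Types (S : seq (npath d)) (w : npath d) (x y z : 'rV[int]_d).

(** The pathwise form of the bound: a point [y <> x] of the cluster of [x] is in
    the cluster, formed without [w], of a vertex of some open [w] through [x]. *)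
Lemma conn_le_sum A S x y : uniq A -> {subset S <= A} ->
  ind (conn [set` S] x y) <= (ind (x = y) : R) + \sum_(w <- A | x \in verts w)
    \sum_(z <- verts w)
      (if w \in S then ind (conn [set` del w S] z y) else 0).
Proof.
move=> uA sSA.
have ge0 w z : 0 <= (if w \in S then ind (conn [set` del w S] z y) else 0) :> R.
  by case: ifP => // _; exact: ind_ge0.
have sum0 : 0 <= \sum_(w <- A | x \in verts w) \sum_(z <- verts w)
      (if w \in S then ind (conn [set` del w S] z y) else 0) :> R.
  by apply: sumr_ge0 => w _; apply: sumr_ge0.
have [c|nc] := pselect (conn [set` S] x y); last first.
  by rewrite {1}/ind asboolF // addr_ge0.
have [xy|xy] := pselect (x = y).
  by rewrite {1 2}/ind !asboolT // lerDl.
have [w [z [wS xw zw h]]] := conn_first c xy.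
apply: (@le_trans _ _ (\sum_(z <- verts w)
      (if w \in S then ind (conn [set` del w S] z y) else 0))); last first.
  rewrite -[leLHS]add0r; apply: lerD => //.
  rewrite [leRHS](big_rem w) /= ?xw; last exact: sSA.
  by rewrite lerDl; apply: sumr_ge0 => v _; apply: sumr_ge0.
rewrite (big_rem z) //= [w \in S]wS.
apply: (@le_trans _ _ (ind (conn [set` del w S] z y))).
  apply: ind_le => _; apply: conn_mono h => v [vS vw] /=.
  by rewrite mem_del vS andbT; apply/eqP.
by rewrite lerDl; apply: sumr_ge0.
Qed.

Variables (p : npath d -> R) (kappa : R).
Hypothesis hp : is_prob p.
Hypothesis kappa_bounds : 0 <= kappa < 1.
Hypothesis sum_kappa : forall x A, uniq A ->
  \sum_(w <- A | x \in verts w) p w * (size (verts w))%:R <= kappa.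

(** The expected number of points of [Y] in the cluster of [x]. *)
Lemma expected_cluster A x (Y : seq 'rV[int]_d) : uniq A -> uniq Y ->
  \sum_(y <- Y) Ex p A (fun S => ind (conn [set` S] x y)) <= (1 - kappa)^-1.
Proof.
have [k n] := ubnP (size A); elim: k A x n => // k IH A x; rewrite ltnS => szA uA uY.
have /andP[k0 k1] := kappa_bounds.
pose M := (1 - kappa)^-1.
have M0 : 0 <= M by rewrite invr_ge0 subr_ge0 ltW.
have step y : Ex p A (fun S => ind (conn [set` S] x y)) <=
    ind (x = y) + \sum_(w <- A | x \in verts w) \sum_(z <- verts w)
      (if w \in A then p w * Ex p (del w A)
          (fun S => ind (conn [set` S] z y)) else 0).
  apply: (@le_trans _ _ (Ex p A (fun S => ind (x = y) +
      \sum_(w <- A | x \in verts w) \sum_(z <- verts w)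
      (if w \in S then ind (conn [set` del w S] z y) else 0)))).
    apply: le_Ex => // S sS; apply: conn_le_sum => //; exact: mem_subseq.
  rewrite ExD Ex_cst Ex_sum lerD2l big_seq_cond [leRHS]big_seq_cond.
  apply: ler_sum => w /andP[wA _]; rewrite Ex_sum; apply: ler_sum => z _.
  by rewrite wA (Ex_del p (fun S => ind (conn [set` S] z y))).
apply: (le_trans (ler_sum _ (fun y _ => step y))).
rewrite big_split /=.
have h1 : \sum_(y <- Y) ind (x = y) <= 1 :> R.
  case xY : (x \in Y); last first.
    rewrite big1_seq // => y /= yY; rewrite /ind asboolF // => xy.
    by rewrite xy yY in xY.
  rewrite (bigD1_seq x) //= big1 ?addr0.
    by rewrite /ind asboolT.
  by move=> y yx; rewrite /ind asboolF // => xy; rewrite xy eqxx in yx.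
have h2 : \sum_(y <- Y) \sum_(w <- A | x \in verts w) \sum_(z <- verts w)
      (if w \in A then p w * Ex p (del w A)
          (fun S => ind (conn [set` S] z y)) else 0) <= kappa * M.
  rewrite exchange_big /=.
  apply: (@le_trans _ _ (\sum_(w <- A | x \in verts w)
     (p w * (size (verts w))%:R) * M)); last first.
    by rewrite -mulr_suml ler_wpM2r // sum_kappa.
  rewrite big_seq_cond [leRHS]big_seq_cond; apply: ler_sum => w /andP[wA _].
  rewrite exchange_big /=.
  have -> : p w * (size (verts w))%:R * M = \sum_(z <- verts w) (p w * M).
    by rewrite big_const_seq count_predT iter_addr_0 -mulrA mulr_natl mulrnAr.
  apply: ler_sum => z _; rewrite wA -mulr_sumr.
  have /andP[p0 _] := hp w; apply: ler_wpM2l => //.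
  apply: IH => //; last exact: filter_uniq.
  apply: leq_trans szA; rewrite size_filter -(count_predC (fun v => v != w) A).
  rewrite -[X in (X < _)%N]addn0 ltn_add2l -has_count; apply/hasP; exists w => //=.
  by rewrite negbK eqxx.
apply: (le_trans (lerD h1 h2)); rewrite /M.
rewrite le_eqVlt; apply/orP; left; apply/eqP; field.
by apply: lt0r_neq0; rewrite subr_gt0.
Qed.

(** Markov's inequality for the size of the cluster. *)
Lemma Ex_large_le A x n : uniq A ->
  n%:R * Ex p A (fun S => ind (large n x [set` S])) <= (1 - kappa)^-1.
Proof.
move=> uA; rewrite -ExZ.
(* all the points that the cluster of [x] may contain *)
pose Y := undup (x :: flatten [seq verts w | w <- A]).
apply: le_trans (expected_cluster x uA (undup_uniq _ : uniq Y)).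
rewrite -Ex_sum; apply: le_Ex => // S /mem_subseq sSA.
have [l|nl] := pselect (large n x [set` S]); last first.
  by rewrite {1}/ind asboolF // mulr0; apply: sumr_ge0 => y _; exact: ind_ge0.
rewrite /ind asboolT // mulr1; case: l => Z [uZ nZ hZ].
have sZY : {subset Z <= Y}.
  move=> y /hZ c; rewrite mem_undup inE; case: eqVneq => //= xy.
  have := conn_sym c => /conn_first[//|w [z [wS yw _ _]]]; first exact/eqP.
  by apply/flattenP; exists (verts w) => //; apply: map_f; exact: sSA.
apply: (@le_trans _ _ (\sum_(y <- Z) ind (conn [set` S] x y))).
  rewrite (eq_big_seq (fun=> 1)); last by move=> y /hZ c; rewrite /ind asboolT.
  by rewrite big_const_seq count_predT iter_addr_0 ler_nat.
rewrite [leRHS](bigID (mem Z)) /= -[leLHS]addr0; apply: lerD;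
  last by apply: sumr_ge0 => y _; exact: ind_ge0.
rewrite -[X in _ <= X]big_filter; rewrite le_eqVlt; apply/orP; left.
apply/eqP/perm_big.
apply: uniq_perm => //; first exact/filter_uniq/undup_uniq.
by move=> y; rewrite mem_filter; case yZ : (y \in Z) => //=; rewrite sZY.
Qed.

End Subcritical.

(** * Paths through a point *)

Section Counting.
Variable d : nat.
Implicit Types (y z : 'rV[int]_d).

(** The unit vectors of the lattice, indexed by a coordinate and a sign. *)
Definition unit_vec (e : 'I_d * bool) : 'rV[int]_d :=
  (if e.2 then 1 else - 1) *: delta_mx 0 e.1.

Lemma adj_unit_vec y z : adj y z -> exists e, z = y + unit_vec e.
Proof.
rewrite /adj => /eqP h.
have sq0 i : 0 <= (y 0 i - z 0 i) ^+ 2 by rewrite sqr_ge0.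
have [i hi] : exists i, y 0 i - z 0 i != 0.
  apply: contrapT => /forallNP H; move: h; rewrite big1 // => i _.
  by have /negP := H i; rewrite negbK => /eqP ->; rewrite expr0n.
rewrite (bigD1 i) //= in h.
have rest : 0 <= \sum_(j < d | j != i) (y 0 j - z 0 j) ^+ 2 by apply: sumr_ge0.
have sqi : 0 < (y 0 i - z 0 i) ^+ 2 by rewrite exprn_even_gt0.
have rest0 : \sum_(j < d | j != i) (y 0 j - z 0 j) ^+ 2 = 0.
  by move: h rest sqi; move: (_ ^+ 2) (\sum_(_ | _) _) => a b; lia.
have eqj j : j != i -> z 0 j = y 0 j.
  move=> ji; have := psumr_eq0P (fun j _ => sq0 j) rest0.
  by move=> /(_ j ji) /eqP; rewrite sqrf_eq0 subr_eq0 => /eqP.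
have : (y 0 i - z 0 i) ^+ 2 = 1 by rewrite -h rest0 addr0.
move=> /eqP; rewrite sqrf_eq1 => /orP[] /eqP hyz.
  exists (i, false); apply/rowP => j; rewrite !mxE /= ?eqxx /=.
  have [->|ji] := eqVneq j i; first by lia.
  by rewrite eqj //; lia.
exists (i, true); apply/rowP => j; rewrite !mxE /= ?eqxx /=.
have [->|ji] := eqVneq j i; first by lia.
by rewrite eqj //; lia.
Qed.

Hypothesis d_gt0 : (0 < d)%N.

(** The direction of a step; the default value is never used on paths. *)
Definition direction y z : 'I_d * bool :=
  odflt (Ordinal d_gt0, true) [pick e | z == y + unit_vec e].

Lemma directionP y z : adj y z -> z = y + unit_vec (direction y z).
Proof.
move=> /adj_unit_vec[e he]; rewrite /direction; case: pickP => [f /eqP //|].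
by move=> /(_ e); rewrite he eqxx.
Qed.

(** Two paths with the same directions are translates of each other. *)
Lemma path_translate y y' s s' : path (@adj d) y s -> path (@adj d) y' s' ->
  pairmap direction y s = pairmap direction y' s' ->
  s' = [seq v + (y' - y) | v <- s].
Proof.
elim: s s' y y' => [|a s IH] [|a' s'] y y' //= /andP[h1 h2] /andP[h1' h2'] [E1 E2].
have aE : a' - a = y' - y.
  by rewrite (directionP h1) (directionP h1') E1 opprD addrACA subrr addr0.
rewrite (IH _ _ _ h2 h2' E2) aE; congr (_ :: _).
by rewrite -aE addrC subrK.
Qed.

(** A path of length [k] through [x] is determined by the time of its first
    visit to [x] and by the directions of its steps. *)
Lemma count_paths_through (x : 'rV[int]_d) k (A : seq (npath d)) : uniq A ->
  (count (fun w => (x \in verts w) && (npath_length w == k)) A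
     <= k.+1 * (2 * d) ^ k)%N.
Proof.
move=> uA; rewrite -size_filter.
set B := seq.filter _ A.
pose f (w : npath d) := (index x (verts w), pairmap direction (val w).1 (val w).2).
pose C := [seq (i, tval t) | i <- iota 0 k.+1,
             t <- enum {: k.-tuple ('I_d * bool)%type}].
have -> : (k.+1 * (2 * d) ^ k = size C)%N.
  rewrite size_allpairs size_iota; congr (_ * _)%N.
  by rewrite -cardE card_tuple card_prod card_ord card_bool mulnC.
have inB w : w \in B -> x \in verts w /\ npath_length w = k.
  by rewrite mem_filter => /andP[/andP[? /eqP]].
have injf : {in B &, injective f}.
  move=> w w' /inB[xw wk] /inB[xw' wk'] E0.
  have E1 : index x (verts w) = index x (verts w') := congr1 fst E0.
  have E2 := congr1 snd E0; rewrite /= in E2.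
  have T := path_translate (valP w) (valP w') E2.
  suff E : (val w').1 - (val w).1 = 0.
    apply: val_inj; rewrite [LHS]surjective_pairing [RHS]surjective_pairing.
    move/eqP: (E); rewrite subr_eq0 => /eqP ->; rewrite T E.
    by congr pair; rewrite -[LHS]map_id; apply: eq_map => v; rewrite addr0.
  have Tv : verts w' = [seq v + ((val w').1 - (val w).1) | v <- verts w].
    by rewrite /verts /= -T addrC subrK.
  have := nth_index x xw'; rewrite -E1 Tv.
  rewrite (nth_map x); last by rewrite index_mem.
  rewrite nth_index // => /eqP; rewrite -subr_eq0 addrAC subrr add0r.
  by move/eqP.
rewrite -(size_map f); apply: uniq_leq_size.
  by rewrite map_inj_in_uniq //; exact: filter_uniq.
move=> _ /mapP[w /inB[xw wk] ->].
have hs : size (pairmap direction (val w).1 (val w).2) == k.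
  by rewrite size_pairmap -wk.
apply/allpairsP; exists (index x (verts w), Tuple hs).
split; [|by rewrite mem_enum|by []].
rewrite mem_iota; apply/andP; split=> //.
rewrite add0n [_.1]/= -wk; by move: xw; rewrite -index_mem.
Qed.

End Counting.

Section Weights.
Variables (R : realType) (d : nat) (T : {posnum R}).

(** The mean number of copies of the path [w] per unit of intensity. *)
Definition path_weight (w : npath d) : R :=
  (2 * d)%:R / (T%:num + 1) *
  (geom_mass T (npath_length w) * (2 * d)%:R ^- npath_length w).

Lemma path_weight_ge0 w : 0 <= path_weight w.
Proof.
by rewrite /path_weight mulr_ge0 ?divr_ge0 // ?mulr_ge0 ?geom_mass_ge0.
Qed.

(** A path [w] is present with probability [open_prob u w] at intensity [u]. *)
Definition open_prob (u : R) (w : npath d) : R := 1 - expR (- (u * path_weight w)).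

Lemma open_prob_is_prob u : 0 <= u -> is_prob (open_prob u).
Proof.
move=> u0 w; rewrite /open_prob subr_ge0 -expR0 ler_expR oppr_le0.
by rewrite mulr_ge0 ?path_weight_ge0 //= gerBl expR_ge0.
Qed.

Lemma open_prob_le u u' w : u <= u' -> open_prob u w <= open_prob u' w.
Proof.
move=> uu'; rewrite lerD2l lerN2 ler_expR lerN2.
by rewrite ler_wpM2r // path_weight_ge0.
Qed.

Lemma open_prob_le_weight u w : open_prob u w <= u * path_weight w.
Proof. by have := expR_ge1Dx (- (u * path_weight w)); rewrite /open_prob; lra. Qed.

(** Each multiplication by [1 - r] lowers the degree of the coefficients. *)
Lemma sum_sqr_geometric (r : R) n : 0 <= r -> r < 1 ->
  \sum_(k < n) (k.+1 ^ 2)%:R * r ^+ k <= 2 / (1 - r) ^+ 3.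
Proof.
move=> r0 r1; have r1' : 0 < 1 - r by rewrite subr_gt0.
have g0 : (1 - r) * \sum_(k < n) r ^+ k <= 1.
  have -> : (1 - r) * \sum_(k < n) r ^+ k = 1 - r ^+ n.
    elim: n => [|n IH]; first by rewrite big_ord0 expr0; ring.
    by rewrite big_ord_recr /= mulrDr IH exprS; ring.
  by rewrite gerBl exprn_ge0.
have g1 : (1 - r) * \sum_(k < n) k.+1%:R * r ^+ k <= \sum_(k < n) r ^+ k.
  have -> : (1 - r) * \sum_(k < n) k.+1%:R * r ^+ k =
      \sum_(k < n) r ^+ k - n%:R * r ^+ n.
    elim: n {g0} => [|n IH]; first by rewrite !big_ord0; ring.
    by rewrite !big_ord_recr /= mulrDr IH exprS -natr1; ring.
  by rewrite gerBl mulr_ge0 ?exprn_ge0.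
have g2 : (1 - r) * \sum_(k < n) (k.+1 ^ 2)%:R * r ^+ k <=
    2 * \sum_(k < n) k.+1%:R * r ^+ k.
  have -> : (1 - r) * \sum_(k < n) (k.+1 ^ 2)%:R * r ^+ k =
      2 * (\sum_(k < n) k.+1%:R * r ^+ k) - \sum_(k < n) r ^+ k
      - (n ^ 2)%:R * r ^+ n.
    elim: n {g0 g1} => [|n IH]; first by rewrite !big_ord0; ring.
    by rewrite !big_ord_recr /= mulrDr IH exprS !natrX -natr1; ring.
  rewrite -addrA -opprD gerBl addr_ge0 // ?mulr_ge0 ?exprn_ge0 //.
  by apply: sumr_ge0 => k _; rewrite exprn_ge0.
rewrite ler_pdivlMr ?exprn_gt0 // mulrC.
move: g0 g1 g2; set S0 := \sum_(k < n) r ^+ k.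
set S1 := \sum_(k < n) _; set S2 := \sum_(k < n) _ => g0 g1 g2.
apply: (@le_trans _ _ ((1 - r) ^+ 2 * (2 * S1))).
  by rewrite exprSr -mulrA ler_wpM2l // exprn_ge0 // ltW.
apply: (@le_trans _ _ ((1 - r) * (2 * S0))).
  rewrite expr2 -mulrA ler_wpM2l //; first exact: ltW.
  by rewrite mulrCA ler_wpM2l.
by rewrite mulrCA ger_pMr.
Qed.

(** Paths through a point, weighted by their number of vertices, have a total
    weight bounded uniformly in the point. *)
Lemma weight_through_le : (0 < d)%N -> exists2 K : R, 0 < K &
  forall (x : 'rV[int]_d) A, uniq A ->
  \sum_(w <- A | x \in verts w) path_weight w * (size (verts w))%:R <= K.
Proof.
move=> d0; pose r : R := T%:num / (T%:num + 1).
have T1 : 0 < T%:num + 1 :> R by [].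
have r0 : 0 <= r by rewrite divr_ge0.
have r1 : r < 1 by rewrite ltr_pdivrMr // mul1r ltrDl.
pose D : R := (2 * d)%:R.
have D0 : 0 < D by rewrite ltr0n muln_gt0.
pose c : R := D / (T%:num + 1) / (T%:num + 1).
have c0 : 0 < c by rewrite /c !divr_gt0.
exists (c * (2 / (1 - r) ^+ 3)).
  by rewrite mulr_gt0 // divr_gt0 // exprn_gt0 // subr_gt0.
move=> x A uA.
pose b k := c * r ^+ k / D ^+ k * k.+1%:R.
have bE w : path_weight w * (size (verts w))%:R = b (npath_length w).
  rewrite /path_weight /geom_mass /b /c -/D -/r -[size (verts w)]/(npath_length w).+1.
  by ring.
pose N := (\max_(w <- A) npath_length w).+1.
have lenN w : w \in A -> (npath_length w < N)%N.
  by move=> wA; rewrite ltnS; rewrite (big_rem w) //= leq_maxl.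
have -> : \sum_(w <- A | x \in verts w) path_weight w * (size (verts w))%:R =
    \sum_(k < N) \sum_(w <- A | (x \in verts w) && (npath_length w == k)) b k.
  rewrite [RHS](eq_bigr (fun k : 'I_N => \sum_(w <- A | x \in verts w)
     if npath_length w == k then b k else 0)); last first.
    by move=> k _; rewrite big_mkcondr.
  rewrite exchange_big /= big_seq_cond [RHS]big_seq_cond.
  apply: eq_bigr => w /andP[wA _]; rewrite bE -big_mkcond /=.
  rewrite (big_pred1 (Ordinal (lenN w wA))) //.
apply: (@le_trans _ _ (c * \sum_(k < N) (k.+1 ^ 2)%:R * r ^+ k)); last first.
  by apply: ler_wpM2l; [exact: ltW|exact: sum_sqr_geometric].
rewrite mulr_sumr; apply: ler_sum => k _.
rewrite big_const_seq iter_addr_0 -[b k *+ _]mulr_natr.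
have bk0 : 0 <= b k.
  apply: mulr_ge0 => //; apply: divr_ge0; last by apply/exprn_ge0/ltW.
  by apply: mulr_ge0; [exact: ltW|exact: exprn_ge0].
apply: (@le_trans _ _ (b k * (k.+1 * (2 * d) ^ k)%:R)).
  by rewrite ler_wpM2l // ler_nat; exact: count_paths_through.
rewrite /b natrM !natrX -/D le_eqVlt; apply/orP; left; apply/eqP.
by field; rewrite expf_neq0 // gt_eqF.
Qed.

End Weights.

(** * Percolation at high intensity *)

Section Supercritical.
Variables (R : realType) (d : nat).
Hypothesis d_gt1 : (1 < d)%N.

(** The quadrant, embedded through the first two coordinates. *)
Definition site (c : nat * nat) : 'rV[int]_d :=
  \row_k (if (k == 0 :> nat)%N then c.1%:Z
          else if (k == 1 :> nat)%N then c.2%:Z else 0).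

Let i0 : 'I_d := Ordinal (ltnW d_gt1).
Let i1 : 'I_d := Ordinal d_gt1.

Lemma site_inj : injective site.
Proof.
move=> [x y] [x' y'] /rowP h.
have := h i0; have := h i1; rewrite !mxE /= => -[->] [->]; by [].
Qed.

Lemma adj_site b c : adj (site c) (site (nxt b c)).
Proof.
pose i := if b then i0 else i1; rewrite /adj (bigD1 i) //= big1.
  by rewrite addr0 !mxE /i /nxt /sw; case: b {i} => /=; apply/eqP; lia.
move=> j ji; rewrite !mxE /nxt /sw.
have : (j != i :> nat) by [].
by rewrite /i; case: b {i ji} => /= /negbTE ->; rewrite subrr expr0n.
Qed.

Lemma lattice_edge_path (e : nat * nat * bool) :
  path (@adj d) (site e.1, [:: site (nxt e.2 e.1)]).1
                (site e.1, [:: site (nxt e.2 e.1)]).2.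
Proof. by rewrite /= adj_site. Qed.

(** The one-step path along an edge of the quadrant. *)
Definition lattice_edge (e : nat * nat * bool) : npath d :=
  exist _ (site e.1, [:: site (nxt e.2 e.1)]) (lattice_edge_path e).

Lemma lattice_edge_inj : injective lattice_edge.
Proof.
move=> [c b] [c' b'] /(congr1 val) /= [/site_inj <-] /site_inj.
by case: c => x y; case: b b' => -[] //= [] ; lia.
Qed.

(** The sites of which both edges to the right and upwards are open play the
    role of the open sites of the blocks. *)
Lemma large_of_good (S : seq (npath d)) n :
  (forall k, (k <= n)%N -> good (fun v => lattice_edge (v, true) \in S /\
      lattice_edge (v, false) \in S) k (0%N, 0%N)) ->
  large n (site (0%N, 0%N)) [set` S].
Proof.
move=> hg.
have [||||s [us ns hs]] := @good_origin_large _
    (fun u v => conn [set` S] (site u) (site v)) _ _ _ _ n hg.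
- by move=> x; exact: conn_refl.
- by move=> x y; exact: conn_sym.
- by move=> x y z; exact: conn_trans.
- move=> b x [h1 h2]; apply: conn_joined; exists (lattice_edge (x, b)).
    by case: b.
  by rewrite /traverses /npath_steps /= inE eqxx.
exists (map site s); split; first by rewrite map_inj_uniq //; exact: site_inj.
- by rewrite size_map ltnW.
- by move=> _ /mapP[v /hs h ->].
Qed.

(* with [n.+2 <= 2 ^ n.+1] the factor [blk n ^ 4 = n.+2 ^ 8] is at most
   [256 ^ n.+1], which the squaring of [256 ^- n.+2] makes up for *)
Let delta : R := 256^-1.

(** The expected number of witnesses of a bad block of level [n] whose edges
    are all closed, if [q] is the probability that an edge is closed. *)
Lemma num_witnesses_le (q : R) n : 0 <= q -> 2 * q <= delta ^+ 2 ->
  (num_witnesses n)%:R * q ^+ (2 ^ n) <= delta ^+ n.+2.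
Proof.
move=> q0 h; have dl0 : 0 < delta by rewrite invr_gt0.
elim: n => [|n IH]; first by rewrite expn0 expr1.
rewrite -[num_witnesses n.+1]/(blk n ^ 4 * num_witnesses n ^ 2)%N.
rewrite (expnS 2 n) [(2 * _)%N]mulnC exprM natrM (natrX _ (blk n) 4)
  (natrX _ (num_witnesses n) 2) -mulrA -exprMn.
have e0 : 0 <= (num_witnesses n)%:R * q ^+ (2 ^ n) by rewrite mulr_ge0 // exprn_ge0.
apply: (@le_trans _ _ ((blk n)%:R ^+ 4 * (delta ^+ n.+2) ^+ 2)).
  apply: ler_wpM2l; first exact: exprn_ge0.
  by rewrite ler_pXn2r // nnegrE exprn_ge0 // ltW.
have hb : (blk n)%:R ^+ 4 * delta ^+ n.+1 <= 1 :> R.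
  rewrite /delta exprVn -natrX -natrX.
  rewrite -(ler_pM2r (_ : 0 < (256 ^ n.+1)%:R)) ?ltr0n ?expn_gt0 //.
  rewrite mulfVK ?mul1r ?pnatr_eq0 ?expn_eq0 //.
  rewrite ler_nat -[256%N]/((2 * 2) ^ 4)%N -expnM mulnC expnM leq_exp2r //.
  rewrite blkE expnMn leq_mul //; have := ltn_expl n.+1 (isT : 1 < 2)%N; lia.
have -> : (blk n)%:R ^+ 4 * (delta ^+ n.+2) ^+ 2 =
   ((blk n)%:R ^+ 4 * delta ^+ n.+1) * delta ^+ n.+3.
  by rewrite -!exprM -mulrA -exprD; congr (_ * _ ^+ _); lia.
by rewrite ler_piMl // exprn_ge0 // ltW.
Qed.

(** Union bound over the levels and over the witnesses. *)
Lemma Ex_large_ge (p : npath d -> R) (q : R) n : is_prob p ->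
  (forall e, p (lattice_edge e) = 1 - q) -> 0 <= q -> 2 * q <= delta ^+ 2 ->
  exists2 A, uniq A &
    2^-1 <= Ex p A (fun S => ind (large n (site (0%N, 0%N)) [set` S])).
Proof.
move=> hp pq q0 hq.
have dl0 : 0 <= delta by rewrite invr_ge0.
pose o := (0%N, 0%N).
pose Wi : seq (seq (nat * nat * bool)) :=
  flatten [seq witnesses k o | k <- iota 0 n.+1].
pose A := undup (map lattice_edge (flatten Wi)).
exists A; first exact: undup_uniq.
pose closed (w : seq (nat * nat * bool)) (S : seq (npath d)) : R :=
  (all (fun v => v \notin S) (map lattice_edge w))%:R.
have closed_ge0 w S : 0 <= closed w S by exact: ler0n.
apply: (@le_trans _ _ (Ex p A (fun S =>
    1 + (-1) * \sum_(k < n.+1) \sum_(w <- witnesses k o) closed w S))); last first.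
  apply: le_Ex => // S _.
  have sum0 : 0 <= \sum_(k < n.+1) \sum_(w <- witnesses k o) closed w S.
    by apply: sumr_ge0 => k _; apply: sumr_ge0.
  have [l|nl] := pselect (large n (site o) [set` S]).
    by rewrite /ind asboolT // mulN1r gerBl.
  rewrite /ind asboolF // mulN1r subr_le0.
  have /existsNP[k /not_implyP[kn]] : ~ (forall k, (k <= n)%N ->
      good (fun v => lattice_edge (v, true) \in S /\
      lattice_edge (v, false) \in S) k o).
    by move=> h; apply: nl; exact: large_of_good.
  move=> /(@bad_witness (fun e => lattice_edge e \in S))[w ww wS].
  rewrite (bigD1 (Ordinal (kn : (k < n.+1)%N))) //= (big_rem w) //=.
  rewrite {1}/closed; have -> : all (fun v => v \notin S) (map lattice_edge w).
    by apply/allP => _ /mapP[e ew ->]; apply/negP; exact: wS.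
  rewrite -addrA lerDl addr_ge0 //; first exact: sumr_ge0.
  by apply: sumr_ge0 => i _; apply: sumr_ge0.
rewrite ExD Ex_cst ExZ Ex_sum.
suff : \sum_(k < n.+1) Ex p A (fun S => \sum_(w <- witnesses k o) closed w S) <= 2^-1.
  by lra.
apply: (@le_trans _ _ (\sum_(k < n.+1) delta ^+ k.+2)); last first.
  suff : \sum_(k < n.+1) delta ^+ k.+2 <= 2^-1 - delta ^+ n.+1.
    have : 0 <= delta ^+ n.+1 by rewrite exprn_ge0.
    by lra.
  elim: (n) => [|m IH].
    by rewrite big_ord1 /delta expr1 expr2; lra.
  rewrite big_ord_recr /=.
  have : 0 <= delta ^+ m by rewrite exprn_ge0.
  move: IH; rewrite !exprS /delta; move: (\sum_(_ < _) _) (256^-1 ^+ m) => a b.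
  by lra.
apply: ler_sum => k _; apply: le_trans (num_witnesses_le k q0 hq).
rewrite Ex_sum.
apply: (@le_trans _ _ (\sum_(w <- witnesses k o) q ^+ (2 ^ k))); last first.
  rewrite big_const_seq iter_addr_0 count_predT -[leLHS]mulr_natl.
  by apply: ler_wpM2r; [exact: exprn_ge0|rewrite ler_nat size_witnesses].
rewrite big_seq [leRHS]big_seq; apply: ler_sum => w ww.
rewrite /closed (@Ex_closed_cst _ _ _ q).
- by rewrite size_map (witnesses_size ww).
- exact: undup_uniq.
- by rewrite map_inj_uniq ?(witnesses_uniq ww) //; exact: lattice_edge_inj.
- move=> _ /mapP[e ew ->]; rewrite mem_undup; apply/map_f/flattenP.
  exists w => //; apply/flattenP; exists (witnesses k o) => //.
  by apply/mapP; exists (val k) => //; rewrite mem_iota add0n ltn_ord.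
- by move=> _ /mapP[e _ ->].
Qed.

End Supercritical.

(** * The critical intensity *)

Section Phases.
Variables (R : realType) (d : nat) (T : {posnum R}).

(** The probability, in finite collections of paths, that the cluster of some
    fixed point has at least [n] points is bounded below uniformly in [n]. *)
Definition supercritical (u : R) : Prop :=
  exists (x : 'rV[int]_d) (eps : R), 0 < eps /\ forall n, exists2 A, uniq A &
    eps <= Ex (@open_prob R d T u) A (fun S => ind (large n x [set` S])).

Lemma supercritical_mono u u' : 0 <= u -> u <= u' ->
  supercritical u -> supercritical u'.
Proof.
move=> u0 uu' [x [eps [e0 h]]]; exists x, eps; split=> // n.
have [A uA hA] := h n; exists A => //; apply: le_trans hA _.
apply: Ex_le_prob.
- exact: open_prob_is_prob.
- by apply: open_prob_is_prob; exact: le_trans uu'.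
- by move=> w; exact: open_prob_le.
- by move=> S S' sub; apply: ind_le; apply: large_mono => w /= /sub.
Qed.

Lemma supercritical_high : (1 < d)%N -> exists2 u : R, 0 < u & supercritical u.
Proof.
move=> d1.
pose c : R := (2 * d)%:R / (T%:num + 1) * (geom_mass T 1 * (2 * d)%:R ^- 1).
have D0 : 0 < (2 * d)%:R :> R by rewrite ltr0n muln_gt0; exact: ltnW.
have c0 : 0 < c.
  apply: mulr_gt0; first exact: divr_gt0.
  apply: mulr_gt0; last by rewrite invr_gt0 exprn_gt0.
  by rewrite /geom_mass mulr_gt0 // exprn_gt0 // divr_gt0.
(* the largest probability of a closed edge covered by [Ex_large_ge] *)
pose q : R := 2^-1 * 256^-1 ^+ 2.
have q0 : 0 < q by rewrite /q mulr_gt0 // exprn_gt0.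
have q1 : q < 1 by rewrite /q expr2; lra.
pose u := - ln q / c.
have u0 : 0 < u by rewrite /u divr_gt0 // oppr_gt0 ln_lt0 // q0.
exists u => //; exists (site d (0%N, 0%N)), 2^-1; split=> // n.
apply: (@Ex_large_ge _ _ d1 _ q) => //.
- by apply: open_prob_is_prob; exact: ltW.
- move=> e; rewrite /open_prob /path_weight /= -/c /u divfK ?gt_eqF //.
  by rewrite opprK lnK.
- exact: ltW.
- by rewrite /q mulrA divff // mul1r.
Qed.

Lemma not_supercritical_low : (0 < d)%N ->
  exists2 u0 : R, 0 < u0 & forall u, 0 <= u -> u <= u0 -> ~ supercritical u.
Proof.
move=> d0; have [K K0 hK] := weight_through_le T d0.
exists (2^-1 / K); first by rewrite divr_gt0.
move=> u u0 uK [x [eps [e0 h]]].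
have hk (y : 'rV[int]_d) A : uniq A ->
    \sum_(w <- A | y \in verts w) open_prob T u w * (size (verts w))%:R <= 2^-1.
  move=> uA; apply: (@le_trans _ _ (u * K)); last by rewrite -ler_pdivlMr.
  apply: (@le_trans _ _ (u * \sum_(w <- A | y \in verts w)
      path_weight T w * (size (verts w))%:R)); last exact/ler_wpM2l/hK.
  rewrite mulr_sumr; apply: ler_sum => w _; rewrite mulrA.
  by apply: ler_wpM2r => //; exact: open_prob_le_weight.
pose n := (Num.truncn (2 / eps)).+1.
have [A uA hA] := h n.
have half : 0 <= (2^-1 : R) < 1 by lra.
have := Ex_large_le (open_prob_is_prob _ u0) half hk x n uA.
have -> : (1 - 2^-1)^-1 = 2 :> R by field.
apply/negP; rewrite -ltNge.
apply: (@lt_le_trans _ _ (n%:R * eps)); last by rewrite ler_wpM2l.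
by rewrite -ltr_pdivrMr // truncnS_gt.
Qed.

End Phases.

(** * The open paths of a finitary random interlacement *)

Section Intensity.
Variables (R : realType) (d : nat) (u T : {posnum R}).

Lemma esum_single (I : choiceType) (f : I -> \bar R) i :
  (0 <= f i)%E -> (forall j, j != i -> f j = 0%E) ->
  (\esum_(j in [set: I]) f j = f i)%E.
Proof.
move=> fi f0; rewrite -(esum_set1 fi) [RHS]esum_mkcond; apply: eq_esum => j _.
by case: ifPn => //; rewrite notin_setE /= => /eqP; exact: f0.
Qed.

Lemma srw_law_set1 x k (w : npath d) :
  srw_law R x k [set w] = (srw_mass R x k w)%:E.
Proof.
rewrite /srw_law /= /msumT (@esum_single _ _ w) /=.
- by rewrite /mscale /= diracE mem_set // mule1.
- by rewrite /mscale /= mule_ge0 // lee_fin srw_mass_ge0.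
- move=> v vw; rewrite /mscale /= diracE memNset ?mule0 //.
  by move=> /= vw'; rewrite vw' eqxx in vw.
Qed.

Lemma srw_mass_path (w : npath d) :
  srw_mass R (npath_start w) (npath_length w) w =
  (2 * d)%:R ^- npath_length w.
Proof.
rewrite /srw_mass !eqxx /= /npath_steps /npath_length.
case: w => -[x s] /= ps; elim: s x ps => [|y s IH] x /=.
  by rewrite big_nil expr0 invr1.
move=> /andP[xy ys]; rewrite big_cons IH // /srw_step /= xy exprS.
by rewrite invfM.
Qed.

Lemma killed_walk_set1 x (w : npath d) :
  killed_walk T x [set w] = (if npath_start w == x then
    geom_mass T (npath_length w) * (2 * d)%:R ^- npath_length w else 0)%:E.
Proof.
rewrite /killed_walk /= /mseries nneseries_esumT; last first.
  by move=> k; exact: measure_ge0.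
rewrite (@esum_single _ _ (npath_length w)) /=.
- rewrite /mscale /= srw_law_set1.
  case: eqVneq => [<-|xw]; first by rewrite srw_mass_path.
  by rewrite /srw_mass (negbTE xw) /= mule0.
- exact: measure_ge0.
- move=> k kw; rewrite /mscale /= srw_law_set1 /srw_mass.
  by rewrite [_ == k]eq_sym (negbTE kw) andbF mule0.
Qed.

Lemma fri_intensity_set1 (w : npath d) :
  fri_intensity d u T [set w] = (u%:num * path_weight T w)%:E.
Proof.
rewrite /fri_intensity /= /mscale /= /msumT (@esum_single _ _ (npath_start w)) /=.
- by rewrite /mscale /= killed_walk_set1 eqxx.
- by rewrite /mscale /= mule_ge0 // lee_fin.
- by move=> x xw; rewrite /mscale /= killed_walk_set1 eq_sym (negbTE xw) mule0.
Qed.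

End Intensity.

Section OpenPaths.
Variables (R : realType) (d : nat) (u T : {posnum R}).
Variables (disp : measure_display) (Omega : measurableType disp).
Variables (P : probability Omega R) (FI : Omega -> {measure set (npath d) -> \bar R}).
Hypothesis FI_ppp : finitary_interlacement u T P FI.
Implicit Types (w : npath d) (A C : seq (npath d)) (F G : seq (npath d) -> Prop).

Let p : npath d -> R := open_prob T u%:num.

(** The process charges [w]. *)
Definition is_open (omega : Omega) w : bool := (0 < FI omega [set w])%E.

(** The paths of [A] that are open, in the order of [A]. *)
Definition opens A (omega : Omega) : seq (npath d) := [seq w <- A | is_open omega w].

(** Probabilities as real numbers. *)
Definition prob (D : set Omega) : R := fine (P D).

Lemma probE D : measurable D -> P D = (prob D)%:E.
Proof. by move=> mD; rewrite fineK // fin_num_measure. Qed.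

Lemma probU D D' : measurable D -> measurable D' -> D `&` D' = set0 ->
  prob (D `|` D') = prob D + prob D'.
Proof.
move=> mD mD' DD'; rewrite /prob measureU //= fineD //; exact: fin_num_measure.
Qed.

Lemma measurable_is_open w : measurable [set omega | is_open omega w].
Proof.
have := ppp_measurable FI_ppp (A := [set w]) I measurableT
   (emeasurable_itv `]0%E, +oo[).
rewrite setTI; congr measurable; apply/seteqP; split => omega /=;
  by rewrite in_itv /= andbT.
Qed.

Lemma prob_closed w : prob [set omega | ~~ is_open omega w] = 1 - p w.
Proof.
have := ppp_poisson FI_ppp (A := [set w]) I (fri_intensity_set1 u T w) 0.
rewrite /prob.
have -> : [set omega | FI omega [set w] = 0%:R%:E] =
          [set omega | ~~ is_open omega w].
  apply/seteqP; split => omega /=; rewrite /is_open lt0e measure_ge0 andbT.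
    by move=> ->; rewrite eqxx.
  by rewrite negbK => /eqP.
move=> ->; rewrite /p /open_prob subKr /poisson_prob.
have r0 : 0 <= u%:num * path_weight T w by rewrite mulr_ge0 ?path_weight_ge0.
case: ltP => [r_gt0|r_le0].
  rewrite esum_set1 ?lee_fin ?poisson_pmf_ge0 //= /poisson_pmf r_gt0.
  by rewrite fact0 expr0 divr1 mul1r.
have -> : u%:num * path_weight T w = 0 by apply/eqP; rewrite eq_le r_le0.
by rewrite diracE mem_set //= oppr0 expR0.
Qed.

Lemma prob_open w : prob [set omega | is_open omega w] = p w.
Proof.
have mO := measurable_is_open w.
have : prob [set: Omega] = 1 by rewrite /prob probability_setT.
rewrite -(setvU [set omega | is_open omega w]) probU ?setICl //; last first.
  exact: measurableC.
have -> : ~` [set omega | is_open omega w] = [set omega | ~~ is_open omega w].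
  by apply/seteqP; split => omega /= /negP.
by rewrite prob_closed; lra.
Qed.

(** The event that the state of each path in [C] is prescribed by [s]. *)
Definition cyl C (s : npath d -> bool) : set Omega :=
  [set omega | all (fun w => is_open omega w == s w) C].

Lemma cyl_nil s : cyl [::] s = [set: Omega].
Proof. by apply/seteqP; split. Qed.

Lemma cyl_cons w C s :
  cyl (w :: C) s = [set omega | is_open omega w == s w] `&` cyl C s.
Proof. by apply/seteqP; split => omega /= => [/andP|[? ?]]; [|apply/andP]. Qed.

Lemma measurable_state w b : measurable [set omega | is_open omega w == b].
Proof.
have mO := measurable_is_open w; case: b.
  suff <- : [set omega | is_open omega w] = [set omega | is_open omega w == true] by [].
  by apply/seteqP; split => omega /=; case: is_open.
move/measurableC: mO; congr measurable; apply/seteqP; split => omega /=;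
  by case: is_open.
Qed.

Lemma measurable_cyl C s : measurable (cyl C s).
Proof.
elim: C => [|w C IH]; first by rewrite cyl_nil.
by rewrite cyl_cons; apply: measurableI => //; exact: measurable_state.
Qed.

Lemma prob_cyl C s : uniq C ->
  prob (cyl C s) = \prod_(w <- C) (if s w then p w else 1 - p w).
Proof.
move=> uC.
pose B (i : 'I_(size C)) : set (\bar R) :=
  if s (tnth (in_tuple C) i) then `]0%E, +oo[%classic else `]-oo, 0%E]%classic.
have mB i : measurable (B i) by rewrite /B; case: ifP => _; exact: emeasurable_itv.
have BE omega i : B i (FI omega [set tnth (in_tuple C) i]) =
   (is_open omega (tnth (in_tuple C) i) == s (tnth (in_tuple C) i)) :> Prop.
  rewrite /B /is_open; case: (s _); rewrite /= in_itv /= ?andbT; apply/propext.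
    by case: (_ < _)%E.
  by rewrite leNgt; case: (_ < _)%E.
have tr : trivIset [set: 'I_(size C)] (fun i => [set tnth (in_tuple C) i]).
  move=> i j _ _ [v [vi vj]].
  by apply: (elimT (tuple_uniqP (in_tuple C)) uC); rewrite -[LHS]vi -[RHS]vj.
have := ppp_indep FI_ppp (fun i => I : measurable [set tnth (in_tuple C) i]) tr mB.
rewrite /prob.
have -> : \bigcap_i [set omega | B i (FI omega [set tnth (in_tuple C) i])] = cyl C s.
  apply/seteqP; split => omega /=.
    move=> h; apply/allP => w wC; have := h (Ordinal (etrans (index_mem w C) wC)) I.
    by rewrite /= BE (tnth_nth w) /= nth_index.
  by move=> /allP h i _; rewrite /= BE; apply: h; exact: mem_tnth.
move=> ->.
have st i : P [set omega | B i (FI omega [set tnth (in_tuple C) i])] =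
  (if s (tnth (in_tuple C) i) then p (tnth (in_tuple C) i)
   else 1 - p (tnth (in_tuple C) i))%:E.
  have -> : [set omega | B i (FI omega [set tnth (in_tuple C) i])] =
     [set omega | is_open omega (tnth (in_tuple C) i) == s (tnth (in_tuple C) i)].
    by apply/seteqP; split => omega; rewrite /= BE.
  rewrite probE; last exact: measurable_state.
  congr (_%:E); case: (s _).
    by rewrite -prob_open; congr prob; apply/seteqP; split => omega /=; case: is_open.
  by rewrite -prob_closed; congr prob; apply/seteqP; split => omega /=; case: is_open.
rewrite (eq_bigr _ (fun i _ => st i)).
rewrite prodEFin /= [RHS]big_tnth; exact: eq_bigr.
Qed.

(** The event that the open paths of [A] have the property [F]. *)
Definition event F A : set Omega := [set omega | F (opens A omega)].

Lemma event_cons F w A : event F (w :: A) =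
  ([set omega | is_open omega w == true] `&` event (fun S => F (w :: S)) A) `|`
  ([set omega | is_open omega w == false] `&` event F A).
Proof.
apply/seteqP; rewrite /event /opens; split => omega /=.
  by case: is_open => h; [left|right].
by case: is_open => -[[]|[]].
Qed.

Lemma measurable_event F A : measurable (event F A).
Proof.
elim: A F => [|w A IH] F.
  have [f|f] := pselect (F [::]).
    by rewrite (_ : event _ _ = setT) //; apply/seteqP; split.
  by rewrite (_ : event _ _ = set0) //; apply/seteqP; split.
rewrite event_cons; apply: measurableU; apply: measurableI => //;
  exact: measurable_state.
Qed.

(** [D] is independent of the states of the paths outside [B]. *)
Definition indep_outside (B : seq (npath d)) (D : set Omega) : Prop :=
  measurable D /\ forall C s, uniq C -> (forall w, w \in C -> w \notin B) ->
    prob (D `&` cyl C s) = prob D * prob (cyl C s).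

(** By induction on [A], conditioning on its first path, whose state joins the
    cylinder [cyl C s]. *)
Lemma prob_event_cyl B D F A C s : indep_outside B D -> uniq (A ++ C) ->
  (forall w, w \in A ++ C -> w \notin B) ->
  prob (D `&` event F A `&` cyl C s) =
  prob D * Ex p A (fun S => ind (F S)) * prob (cyl C s).
Proof.
move=> [mD iD]; elim: A F C s => [|w A IH] F C s uAC hB.
  rewrite /= /ind; have [f|f] := pselect (F [::]).
    have -> : event F [::] = [set: Omega] by apply/seteqP; split.
    by rewrite setIT iD // asboolT // mulr1.
  have -> : event F [::] = set0 by apply/seteqP; split.
  by rewrite setI0 set0I asboolF // /prob measure0 mulr0 mul0r.
move: (uAC); rewrite cat_cons cons_uniq => /andP[wAC uAC'].
have wC : w \notin C by apply: contra wAC; rewrite mem_cat => ->; rewrite orbT.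
have uC : uniq C by move: uAC'; rewrite cat_uniq => /and3P[].
pose t b v := if v == w then b else s v.
have cylt b : cyl (w :: C) (t b) = [set omega | is_open omega w == b] `&` cyl C s.
  rewrite cyl_cons {1}/t eqxx; congr (_ `&` _); rewrite /cyl; apply/seteqP.
  split=> omega /= /allP h; apply/allP => v vC; have := h v vC; rewrite /t;
    by case: (eqVneq v w) => // vw; rewrite -vw vC in wC.
have prt b : prob (cyl (w :: C) (t b)) = (if b then p w else 1 - p w) * prob (cyl C s).
  rewrite !prob_cyl //=; last by rewrite wC.
  rewrite big_cons /t eqxx; congr (_ * _); apply: eq_big_seq => v vC.
  by case: (eqVneq v w) => // vw; rewrite -vw vC in wC.
have uAwC : uniq (A ++ w :: C) by rewrite -cat1s uniq_catCA.
have hB' v : v \in A ++ w :: C -> v \notin B.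
  by move=> h; apply: hB; move: h; rewrite /= !(mem_cat, inE) orbCA.
have -> : D `&` event F (w :: A) `&` cyl C s =
   (D `&` event (fun S => F (w :: S)) A `&` cyl (w :: C) (t true)) `|`
   (D `&` event F A `&` cyl (w :: C) (t false)).
  rewrite !cylt event_cons; apply/seteqP; split=> omega /=.
    by move=> [[? [[? ?]|[? ?]]] ?]; [left|right].
  by move=> [[[? ?] [? ?]]|[[? ?] [? ?]]]; split => //; split => //; [left|right].
rewrite probU.
- by rewrite !IH // !prt /=; ring.
- apply: measurableI; last exact: measurable_cyl.
  by apply: measurableI => //; exact: measurable_event.
- apply: measurableI; last exact: measurable_cyl.
  by apply: measurableI => //; exact: measurable_event.
- by apply/seteqP; split => // omega; rewrite !cylt /= => -[[_ [/eqP -> _]] [_ []]].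
Qed.

Lemma prob_event_indep B D F A : indep_outside B D -> uniq A ->
  (forall w, w \in A -> w \notin B) ->
  prob (D `&` event F A) = prob D * Ex p A (fun S => ind (F S)).
Proof.
move=> iD uA hB.
have := @prob_event_cyl B D F A [::] xpredT iD; rewrite !cats0 cyl_nil setIT.
by move=> ->//; rewrite /prob probability_setT /= mulr1.
Qed.

Lemma indep_outside_setT : indep_outside [::] [set: Omega].
Proof.
by split => // C s _ _; rewrite setTI /prob probability_setT /= mul1r.
Qed.

Lemma prob_event F A : uniq A -> prob (event F A) = Ex p A (fun S => ind (F S)).
Proof.
move=> uA; have := prob_event_indep F indep_outside_setT uA.
by rewrite setTI => -> //; rewrite /prob probability_setT /= mul1r.
Qed.

Lemma indep_event F A : uniq A -> indep_outside A (event F A).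
Proof.
move=> uA; split=> [|C s uC hC]; first exact: measurable_event.
have := @prob_event_cyl [::] setT F A C s indep_outside_setT.
rewrite setTI prob_event // /prob probability_setT /= mul1r; apply => //.
by rewrite cat_uniq uA uC andbT /=; apply/hasPn.
Qed.

(** Events about disjoint sets of paths are independent. *)
Lemma prob_event_disjoint F G A A' : uniq A -> uniq A' ->
  (forall w, w \in A' -> w \notin A) ->
  prob (event F A `&` event G A') = prob (event F A) * prob (event G A').
Proof.
move=> uA uA' h; rewrite (prob_event_indep _ (indep_event F uA)) //.
by rewrite (prob_event G).
Qed.

End OpenPaths.

(** * Zero-one law and conclusion *)

Section ZeroOne.
Variables (R : realType) (d : nat) (u T : {posnum R}).
Variables (disp : measure_display) (Omega : measurableType disp).
Variables (P : probability Omega R) (FI : Omega -> {measure set (npath d) -> \bar R}).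
Hypothesis FI_ppp : finitary_interlacement u T P FI.
Implicit Types (D : set Omega) (G : nat -> set Omega) (B : seq (npath d))
  (X : seq 'rV[int]_d).

Local Notation prob := (prob P).

Lemma prob_mono D D' : measurable D -> measurable D' -> D `<=` D' ->
  prob D <= prob D'.
Proof.
move=> mD mD' sub; rewrite -lee_fin -!probE //.
by apply: le_measure => //; exact/mem_set.
Qed.

Lemma prob_bigcup_cvg G : (forall n, measurable (G n)) ->
  (forall n m, (n <= m)%N -> G n `<=` G m) ->
  (fun n => P (G n)) @ \oo --> P (\bigcup_n G n).
Proof.
move=> mG hG; apply: nondecreasing_cvg_mu => //; first exact: bigcup_measurable.
by move=> n m nm; rewrite subsetEset; exact: hG.
Qed.

Lemma prob_bigcap_cvg G : (forall n, measurable (G n)) ->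
  (forall n m, (n <= m)%N -> G m `<=` G n) ->
  (fun n => P (G n)) @ \oo --> P (\bigcap_n G n).
Proof.
move=> mG hG; apply: nonincreasing_cvg_mu => //.
- exact: le_lt_trans (probability_le1 P (mG 0)) (ltry 1).
- exact: bigcap_measurable.
- by move=> n m nm; rewrite subsetEset; exact: hG.
Qed.

(** The class of events independent of [D] is closed under monotone limits. *)
Lemma indep_lim D G L : measurable D -> measurable L ->
  (forall n, measurable (G n)) ->
  (fun n => P (G n)) @ \oo --> P L ->
  (fun n => P (D `&` G n)) @ \oo --> P (D `&` L) ->
  (forall n, prob (D `&` G n) = prob D * prob (G n)) ->
  prob (D `&` L) = prob D * prob L.
Proof.
move=> mD mL mG cG cDG h.
have cDG' : (fun n => P (D `&` G n)) @ \oo --> (P D * P L)%E.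
  rewrite (_ : (fun n => P (D `&` G n)) = (fun n => P D * P (G n))%E).
    by apply: cvgeZl => //; exact: fin_num_measure.
  apply/funext => n; rewrite (probE P (measurableI _ _ mD (mG n))) h EFinM.
  by rewrite (probE P mD) (probE P (mG n)).
have := cvg_unique (@ereal_hausdorff R) cDG cDG'.
rewrite (probE P (measurableI _ _ mD mL)) (probE P mD) (probE P mL).
by rewrite -EFinM => H; apply: EFin_inj; exact: H.
Qed.

Lemma indep_bigcup D G : measurable D -> (forall n, measurable (G n)) ->
  (forall n m, (n <= m)%N -> G n `<=` G m) ->
  (forall n, prob (D `&` G n) = prob D * prob (G n)) ->
  prob (D `&` \bigcup_n G n) = prob D * prob (\bigcup_n G n).
Proof.
move=> mD mG hG; apply: indep_lim => //.
- exact: bigcup_measurable.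
- exact: prob_bigcup_cvg.
- rewrite setI_bigcupr; apply: prob_bigcup_cvg.
    by move=> n; exact: measurableI.
  by move=> n m nm; apply: setIS; exact: hG.
Qed.

Lemma indep_bigcap D G : measurable D -> (forall n, measurable (G n)) ->
  (forall n m, (n <= m)%N -> G m `<=` G n) ->
  (forall n, prob (D `&` G n) = prob D * prob (G n)) ->
  prob (D `&` \bigcap_n G n) = prob D * prob (\bigcap_n G n).
Proof.
move=> mD mG hG; apply: indep_lim => //.
- exact: bigcap_measurable.
- exact: prob_bigcap_cvg.
- have -> : D `&` \bigcap_n G n = \bigcap_n (D `&` G n).
    apply/seteqP; split => [omega [Do Go] n _|omega h]; first by split => //; exact: Go.
    by split=> [|n _]; [have [] := h 0 I|have [] := h n I].
  apply: prob_bigcap_cvg; first by move=> n; exact: measurableI.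
  by move=> n m nm; apply: setIS; exact: hG.
Qed.

(** The first elements of a countable type. *)
Definition initial (I : countType) (m : nat) : seq I := pmap (@pickle_inv I) (iota 0 m).

Lemma mem_initial (I : countType) m (x : I) : (x \in initial I m) = (pickle x < m)%N.
Proof.
rewrite mem_pmap; apply/mapP/idP => [[j] | xm].
  rewrite mem_iota add0n => /andP[_ jm] e.
  by have := @pickle_invK I j; rewrite -e /= => ->.
by exists (pickle x); rewrite ?mem_iota ?add0n // pickleK_inv.
Qed.

Lemma initial_uniq (I : countType) m : uniq (initial I m).
Proof. by apply: (pmap_uniq (@pickle_invK I)); exact: iota_uniq. Qed.

Lemma sub_initial (I : countType) (s : seq I) : exists m, {subset s <= initial I m}.
Proof.
elim: s => [|x s [m h]]; first by exists 0.
exists (maxn (pickle x).+1 m) => y; rewrite inE mem_initial => /orP[/eqP ->|/h].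
  by rewrite leq_max leqnn.
by rewrite mem_initial => hy; rewrite leq_max hy orbT.
Qed.

Definition open_set (omega : Omega) : set (npath d) := [set w | is_open FI omega w].

(** Using only the open paths outside [B], resp. only those among the first [m]
    paths, some point of [X] has a cluster of at least [n] points. *)
Definition large_event B X n : set Omega :=
  [set omega | exists2 x, x \in X & large n x (open_set omega `\` [set` B])].

Definition large_event_in B X n m : set Omega :=
  event FI (fun S => exists2 x, x \in X & large n x [set` S])
    [seq w <- initial (npath d) m | w \notin B].

(** Using only the open paths outside [B], some point of [X] has an infinite
    cluster. *)
Definition infinite_event B X : set Omega :=
  [set omega | exists2 x, x \in X &
     forall n, large n x (open_set omega `\` [set` B])].

(** There is an infinite cluster of open paths. *)
Definition percol_event : set Omega := [set omega | percol (open_set omega)].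

Lemma large_event_in_mono B X n m m' : (m <= m')%N ->
  large_event_in B X n m `<=` large_event_in B X n m'.
Proof.
move=> mm' omega [x xX h]; exists x => //; apply: large_mono h => w /=.
rewrite !mem_filter !mem_initial => /and3P[-> -> h] /=.
exact: leq_trans mm'.
Qed.

Lemma bigcup_large_event B X n :
  \bigcup_m large_event_in B X n m = large_event B X n.
Proof.
apply/seteqP; split => [omega [m _ [x xX h]]|omega [x xX h]].
  exists x => //; apply: large_mono h => w /=.
  by rewrite !mem_filter => /and3P[ow wB _]; split => //; exact/negP.
have [s sS l] := large_finite h; have [m hm] := sub_initial s.
exists m => //; exists x => //; apply: large_mono l => w /= ws.
rewrite !mem_filter hm // andbT; have [ow /negP ->] := sS w ws.
by rewrite andbT.
Qed.

Lemma large_event_anti B X n n' : (n <= n')%N ->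
  large_event B X n' `<=` large_event B X n.
Proof.
move=> nn' omega [x xX [Y [uY sY h]]]; exists x => //; exists Y; split => //.
exact: leq_trans sY.
Qed.

Lemma bigcap_large_event B X : \bigcap_n large_event B X n = infinite_event B X.
Proof.
apply/seteqP; split => [omega h|omega [x xX h] n _]; last by exists x.
apply: contrapT => nh.
have {}nh x : x \in X -> exists n, ~ large n x (open_set omega `\` [set` B]).
  by move=> xX; apply: contrapT => /forallNP H; apply: nh; exists x => // n;
    apply: contrapT; exact: H.
have [n hn] : exists n, forall x, x \in X ->
    ~ large n x (open_set omega `\` [set` B]).
  elim: X nh {h} => [|x X IH] nh; first by exists 0.
  have [|n1 h1] := IH; first by move=> y yX; apply: nh; rewrite inE yX orbT.
  have [|n2 h2] := nh x; first by rewrite inE eqxx.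
  exists (maxn n1 n2) => y; rewrite inE => /orP[/eqP ->|/h1 ny] [Y [uY sY hY]].
    by apply: h2; exists Y; split => //; apply: leq_trans sY; exact: leq_maxr.
  by apply: ny; exists Y; split => //; apply: leq_trans sY; exact: leq_maxl.
by have [x /hn] := h n I.
Qed.

Lemma bigcup_infinite_event B :
  \bigcup_k infinite_event B (initial _ k) = percol_event.
Proof.
apply/seteqP; split => [omega [k _ [x _ h]]|omega].
  by apply/(percol_setD (open_set omega) B); exists x; apply/infinite_cluster.
move=> /(percol_setD (open_set omega) B)[x /infinite_cluster h].
by exists (pickle x).+1 => //; exists x => //; rewrite mem_initial.
Qed.

Lemma measurable_large_event_in B X n m : measurable (large_event_in B X n m).
Proof. exact: measurable_event FI_ppp _ _. Qed.

Lemma measurable_large_event B X n : measurable (large_event B X n).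
Proof.
rewrite -bigcup_large_event; apply: bigcup_measurable => m _.
exact: measurable_large_event_in.
Qed.

Lemma measurable_infinite_event B X : measurable (infinite_event B X).
Proof.
rewrite -bigcap_large_event; apply: bigcap_measurable => // n _.
exact: measurable_large_event.
Qed.

Lemma measurable_percol_event : measurable percol_event.
Proof.
rewrite -(bigcup_infinite_event [::]); apply: bigcup_measurable => k _.
exact: measurable_infinite_event.
Qed.

(** Percolation is a triple monotone limit of events about finitely many paths
    outside [B]. *)
Lemma indep_percol_event D B : measurable D ->
  (forall X n m, prob (D `&` large_event_in B X n m) =
     prob D * prob (large_event_in B X n m)) ->
  prob (D `&` percol_event) = prob D * prob percol_event.
Proof.
move=> mD h; rewrite -(bigcup_infinite_event B); apply: indep_bigcup => //.
- by move=> k; exact: measurable_infinite_event.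
- move=> k k' kk' omega [x xk hx]; exists x => //.
  by move: xk; rewrite !mem_initial => /leq_trans; apply.
move=> k; rewrite -bigcap_large_event; apply: indep_bigcap => //.
- by move=> n; exact: measurable_large_event.
- by move=> n n'; exact: large_event_anti.
move=> n; rewrite -bigcup_large_event; apply: indep_bigcup => //.
- by move=> m; exact: measurable_large_event_in.
- by move=> m m'; exact: large_event_in_mono.
Qed.

(** The event of percolation is independent of the events about finitely many
    paths, hence of their limits, hence of itself. *)
Lemma percol_event01 : prob percol_event = 0 \/ prob percol_event = 1.
Proof.
have mE := measurable_percol_event.
have fin F A : uniq A -> prob (event FI F A `&` percol_event) =
    prob (event FI F A) * prob percol_event.
  move=> uA; apply: (@indep_percol_event _ A); first exact: measurable_event FI_ppp _ _.
  move=> X n m; apply: (prob_event_disjoint FI_ppp) => //.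
    by apply: filter_uniq; exact: initial_uniq.
  by move=> w; rewrite mem_filter => /andP[].
have : prob (percol_event `&` percol_event) = prob percol_event * prob percol_event.
  apply: (@indep_percol_event _ [::]) => // X n m.
  rewrite setIC fin 1?mulrC //; apply: filter_uniq; exact: initial_uniq.
rewrite setIid => /eqP; rewrite -subr_eq0 -{1}[prob percol_event]mulr1 -mulrBr.
by rewrite mulf_eq0 subr_eq0 => /orP[/eqP ->|/eqP <-]; [left|right].
Qed.

Lemma supercritical_percol : supercritical d T u%:num -> prob percol_event = 1.
Proof.
move=> [x [eps [e0 h]]].
have [E0|//] := percol_event01.
have ge_eps n : (eps%:E <= P (large_event [::] [:: x] n))%E.
  have [A uA hA] := h n; rewrite (probE P (measurable_large_event _ _ _)).
  rewrite lee_fin; apply: le_trans hA _; rewrite -(prob_event FI_ppp) //.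
  apply: prob_mono.
  - exact: measurable_event FI_ppp _ _.
  - exact: measurable_large_event.
  move=> omega l; exists x; first by rewrite inE.
  by apply: large_mono l => w /=; rewrite mem_filter => /andP[ow _]; split.
have : (eps%:E <= P (infinite_event [::] [:: x]))%E.
  rewrite -bigcap_large_event.
  have := @prob_bigcap_cvg (large_event [::] [:: x]) (measurable_large_event _ _)
     (fun n m nm => @large_event_anti _ _ n m nm).
  by apply: cvge_ge; apply: nearW.
rewrite (probE P (measurable_infinite_event _ _)).
rewrite lee_fin => le_eps; exfalso.
have : prob (infinite_event [::] [:: x]) <= prob percol_event.
  apply: prob_mono; first exact: measurable_infinite_event.
    exact: measurable_percol_event.
  move=> omega [y _ hy]; apply/(percol_setD (open_set omega) [::]).
  by exists y; apply/infinite_cluster.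
by rewrite E0; lra.
Qed.

Lemma not_supercritical_percol :
  ~ supercritical d T u%:num -> P.-negligible percol_event.
Proof.
move=> nsup.
have zero x : P (infinite_event [::] [:: x]) = 0%E.
  have mI := measurable_infinite_event [::] [:: x].
  apply/eqP; rewrite eq_le measure_ge0 andbT (probE P mI) lee_fin.
  apply/ler_addgt0Pl => eps e0; rewrite addr0.
  have [n hn] : exists n, forall A, uniq A ->
      Ex (open_prob T u%:num) A (fun S => ind (large n x [set` S])) < eps.
    apply: contrapT => /forallNP H; apply: nsup; exists x, eps; split => // n.
    apply: contrapT => H'; apply: (H n) => A uA; rewrite ltNge; apply/negP => hA.
    by apply: H'; exists A.
  apply: (@le_trans _ _ (prob (large_event [::] [:: x] n))).
    apply: prob_mono => //; first exact: measurable_large_event.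
    by move=> omega [y yx hy]; exists y.
  rewrite -lee_fin -(probE P (measurable_large_event _ _ _)).
  rewrite -bigcup_large_event.
  have := @prob_bigcup_cvg (large_event_in [::] [:: x] n)
     (measurable_large_event_in _ _ _) (@large_event_in_mono _ _ _).
  apply: cvge_le; apply: nearW => m /=.
  rewrite (probE P (measurable_large_event_in _ _ _ _)).
  have uA := filter_uniq (fun w => w \notin [::]) (initial_uniq (npath d) m).
  rewrite lee_fin /large_event_in (prob_event FI_ppp) //.
  apply: le_trans (ltW (hn _ uA)); apply: le_Ex.
    exact: open_prob_is_prob.
  by move=> S _; apply: ind_le => -[y]; rewrite inE => /eqP ->.
apply: (@negligibleS _ _ _ _ (\bigcup_j (if @pickle_inv 'rV[int]_d j is Some x
    then infinite_event [::] [:: x] else set0))).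
  move=> omega; rewrite -(bigcup_infinite_event [::]) => -[k _ [x _ hx]].
  exists (choice.pickle x) => //; rewrite pickleK_inv.
  by exists x => //; rewrite inE.
apply: negligible_bigcup => j; case: pickle_inv => [x|]; last exact: negligible_set0.
exists (infinite_event [::] [:: x]).
by split; [exact: measurable_infinite_event|exact: zero|].
Qed.

End ZeroOne.

Theorem theorem4 (R : realType) (d : nat) (hd : (3 <= d)%N) (T : {posnum R}) :
  exists u_c : {posnum R}, forall (u : {posnum R})
    (disp : measure_display) (Omega : measurableType disp)
    (P : probability Omega R) (FI : Omega -> {measure set (npath d) -> \bar R}),
    finitary_interlacement u T P FI ->
    (u_c%:num < u%:num -> {ae P, forall w, percolates (FI w)}) /\
    (u%:num < u_c%:num -> {ae P, forall w, ~ percolates (FI w)}).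
Proof.
have d1 : (1 < d)%N by exact: ltnW.
have [u0 u0_gt0 low] := not_supercritical_low T (ltnW d1).
have [u1 u1_gt0 high] := supercritical_high T d1.
pose U : set R := [set u | 0 < u /\ supercritical d T u].
have U_lb : lbound U u0.
  move=> u [u_gt0 su]; rewrite leNgt; apply/negP => uu0.
  by apply: (low u) => //; exact: ltW.
have U_ne : U !=set0 by exists u1.
have uc_gt0 : 0 < inf U.
  by apply: lt_le_trans u0_gt0 _; exact: lb_le_inf.
exists (PosNum uc_gt0) => u disp Omega P FI FI_ppp; split => /= hu.
  have [v [v_gt0 sv] vu] := inf_lt U_ne hu.
  have su : supercritical d T u%:num.
    by apply: supercritical_mono sv; exact: ltW.
  have mE := measurable_percol_event FI_ppp.
  exists (~` percol_event FI); split; first exact: measurableC.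
    rewrite probability_setC // (probE P mE) (supercritical_percol FI_ppp su).
    by rewrite subee.
  by apply: subsetC.
have nsu : ~ supercritical d T u%:num.
  by move=> su; move: hu; rewrite ltNge => /negP; apply; apply: ge_inf => //;
    exists u0.
apply: negligibleS (not_supercritical_percol FI_ppp nsu).
by move=> omega /= /contrapT.
Qed.
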